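(* Let $k\in \mathbb{N}$, $Q,N\ge 1$, and let $(a_n)_{n\in \mathbb{Z}[i]}$ be any sequence of complex numbers. Set $\kappa:=2^{k-1}$. Then for every $\varepsilon>0$, \[ \sum_{\substack{q\in \mathbb{Z}[i]\setminus\{0\}\\ \mathcal{N}(q)\le Q}} \ \sum_{\substack{r \bmod{q^k}\\ (r,q)=1}} \left|\sum_{\substack{n\in \mathbb{Z}[i]\\ \mathcal{N}(n)\le N}} a_n \, e\!\left(\Re\!\left(\frac{nr}{q^k}\right)\right)\right|^2 \ll (QN)^{\varepsilon}\left(Q^{k+1}+NQ^{1-1/\kappa}+N^{1-1/\kappa}Q^{1+k/\kappa}\right) \sum_{\substack{n\in \mathbb{Z}[i]\\ \mathcal{N}(n)\le N}} |a_n|^2, \] where the implied constant depends only on $k$ and $\varepsilon$.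
   Context: For $q\in\mathbb{Z}[i]$, $\mathcal{N}(q)=\Re(q)^2+\Im(q)^2$ is its norm. $e(x)=e^{2\pi i x}$. The inner sum over $r$ runs over a system of representatives of the residue classes modulo $q^k$ in $\mathbb{Z}[i]$ with $r$ coprime to $q$. *)

(* Defs.v *)
From HB Require Import structures.
From mathcomp Require Import all_boot all_order all_algebra.
From mathcomp Require Import ring.
From mathcomp Require Import all_classical all_reals all_analysis.
From mathcomp Require Export complex.

Set Implicit Arguments.
Unset Strict Implicit.
Unset Printing Implicit Defensive.

Import Order.TTheory GRing.Theory Num.Theory.
Local Open Scope classical_set_scope.
Local Open Scope ring_scope.

(* The library makes [complex K] a ring only when K is a field, hence the
   alias and the explicit ring structure on Z[i]. *)
Definition gint : Type := complex int.

HB.instance Definition _ := Countable.on gint.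
HB.instance Definition _ := GRing.Zmodule.on gint.

Definition gone : gint := Complex 1 0.
Definition gmul : gint -> gint -> gint := @ComplexField.mulc int.

Lemma gmul1 : left_id gone gmul.
Proof. by case=> a b; rewrite /gmul /= !mul1r !mul0r subr0 addr0. Qed.

Lemma gmulDl : left_distributive gmul +%R.
Proof.
move=> [a b] [c d] [e f].
rewrite /gmul /=; congr Complex; ring.
Qed.

HB.instance Definition _ := GRing.Zmodule_isComNzRing.Build gint
  (@ComplexField.mulcA int) (@ComplexField.mulcC int) gmul1 gmulDl isT.

Definition gnorm (z : gint) : int := complex.Re z ^+ 2 + complex.Im z ^+ 2.

Definition gdvd (d z : gint) : Prop := exists c : gint, z = d * c.

Definition gcoprime (r q : gint) : Prop :=
  forall d : gint, gdvd d r -> gdvd d q -> gdvd d 1.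

Definition residue_system (m : gint) (S : set gint) : Prop :=
  forall z : gint, exists! r : gint, S r /\ gdvd m (z - r).

Definition gintC (R : realType) (z : gint) : R[i] :=
  Complex (complex.Re z)%:~R (complex.Im z)%:~R.

Definition gball (R : realType) (X : R) : set gint :=
  [set z | (gnorm z)%:~R <= X].

(* e(x) = exp(2 pi i x), by Euler's formula. *)
Definition e (R : realType) (x : R) : R[i] :=
  Complex (cos (2 * pi * x)) (sin (2 * pi * x)).

Definition cabs (R : realType) : R[i] -> R := @ComplexField.Normc.normc R.

(* Main.v *)
Require Import Defs.
From mathcomp Require Import all_boot all_order all_algebra.
From mathcomp Require Import ring lra zify.
From mathcomp Require Import all_classical all_reals all_analysis.

(** By duality and a squared Dirichlet kernel, the sum over any family of points
    of the torus is at most a constant times [K * N] times the sum of the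
    [|a_n|^2], where [K] bounds the number of points in a square of side about
    [1 / sqrt N].  Let [q] run over a dyadic block.  If [r / q^k] is close to
    [r0 / q0^k], then [r0 * q^k] is close to [0] modulo [q0^k].  Taking [k - 1]
    Weyl differences of the set of such [q] gives cubes [(x, h_1, ..., h_(k-1))]
    for which [k! h_1 ... h_(k-1) (2 x + h_1 + ... + h_(k-1))], multiplied by
    [r0], is still close to [0] modulo [q0^k].  As [r0] is invertible there, this
    product takes few values, and by the divisor bound each nonzero value comes
    from [O(Q^eps)] cubes.  Since the number of cubes is bounded below by
    Cauchy's inequality, this bounds the number of
    [q], hence [K].  The dyadic blocks sum up to a geometric series in [2^-eps]. *)

Set Implicit Arguments.
Unset Strict Implicit.
Unset Printing Implicit Defensive.
Import Order.TTheory GRing.Theory Num.Theory numFieldNormedType.Exports.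
Local Open Scope classical_set_scope.
Local Open Scope ring_scope.

Local Notation gnorm := Defs.gnorm.

(** * Gaussian integers *)

(** The exponent [kappa = 2^(k-1)] is the price of [k - 1] uses of Cauchy's inequality: [a]
    denominators of norm about [Q] span at least about [a^kappa Q^(k - kappa)] cubes, against an
    upper bound [Q^(k-1) + (1 + T) Q^eps] up to constants, where [T] is about [Q^(2k) / N] and the
    first term counts the degenerate cubes. Taking the [kappa]-th root and multiplying by [N] yields
    the last two terms of the estimate; when [N <= Q^k], the trivial bound [a << Q] already gives
    the first. A [k]-th difference would be free of [x]; stopping one earlier keeps a linear factor
    in [x], so that the divisors of the product recover the whole cube. Within a dyadic block the
    norm of [q0^k] is comparable to [Q^k], hence to the largest norm the product can have, so that
    each residue class modulo [q0^k] contains only [O(1)] products. *)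

Definition nrm (z : gint) : nat :=
  (absz (complex.Re z) ^ 2 + absz (complex.Im z) ^ 2)%N.

Lemma gnormE (z : gint) : gnorm z = (nrm z)%:Z.
Proof. by rewrite /gnorm /nrm PoszD -!abszX !gez0_abs ?sqr_ge0. Qed.

Lemma gintD (a b c d : int) :
  (Complex a b : gint) + (Complex c d : gint) = Complex (a + c) (b + d).
Proof. by []. Qed.

Lemma gintN (a b : int) : - (Complex a b : gint) = Complex (- a) (- b).
Proof. by []. Qed.

Lemma gintM (a b c d : int) : (Complex a b : gint) * (Complex c d : gint) =
  Complex (a * c - b * d) (a * d + b * c).
Proof. by []. Qed.

Lemma nrmM (x y : gint) : nrm (x * y) = (nrm x * nrm y)%N.
Proof.
apply/eqP; rewrite -eqz_nat PoszM -!gnormE; apply/eqP.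
case: x y => [a b] [c d]; rewrite gintM /gnorm /=; ring.
Qed.

Lemma nrmX (x : gint) n : nrm (x ^+ n) = (nrm x ^ n)%N.
Proof. by elim: n => // n IH; rewrite exprS nrmM IH expnS. Qed.

Lemma nrm_eq0 (x : gint) : (nrm x == 0%N) = (x == 0).
Proof.
case: x => a b; rewrite /nrm /= addn_eq0 !expn_eq0 /= !andbT !absz_eq0.
by apply/andP/eqP => [[/eqP-> /eqP->] | [-> ->]].
Qed.

Lemma nrm_gt0 (x : gint) : (0 < nrm x)%N = (x != 0).
Proof. by rewrite lt0n nrm_eq0. Qed.

Lemma nrmN (x : gint) : nrm (- x) = nrm x.
Proof. by case: x => a b; rewrite gintN /nrm /= !abszN. Qed.

Lemma nrmD_le (x y : gint) : (nrm (x + y)%R <= 2 * nrm x + 2 * nrm y)%N.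
Proof.
suff : gnorm (x + y) <= 2 * gnorm x + 2 * gnorm y by rewrite !gnormE; lia.
case: x y => [a b] [c d]; rewrite gintD /gnorm /=.
have := sqr_ge0 (a - c); have := sqr_ge0 (b - d); rewrite !sqrrD !sqrrN.
lia.
Qed.

Lemma nrmB_le (x y : gint) : (nrm (x - y)%R <= 2 * nrm x + 2 * nrm y)%N.
Proof. by rewrite -(nrmN y) nrmD_le. Qed.

Lemma gmulf_eq0 (x y : gint) : (x * y == 0) = (x == 0) || (y == 0).
Proof. by rewrite -!nrm_eq0 nrmM muln_eq0. Qed.

Lemma gmulIf (x : gint) : x != 0 -> injective (fun y => y * x).
Proof.
move=> x0 y z /= /eqP; rewrite -subr_eq0 -mulrBl gmulf_eq0 (negPf x0) orbF.
by rewrite subr_eq0 => /eqP.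
Qed.

Lemma gexpf_neq0 (x : gint) n : x != 0 -> x ^+ n != 0.
Proof. by rewrite -!nrm_gt0 nrmX expn_gt0 => ->. Qed.

Lemma round_div (u : int) (n : nat) : (0 < n)%N ->
  exists q : int, 4 * (u - q * n%:Z) ^+ 2 <= n%:Z ^+ 2.
Proof.
(* The integer nearest to [u / n], as the floor of [u / n + 1 / 2]. *)
move=> n0; exists ((2 * u + n%:Z) %/ (2 * n%:Z))%Z.
set q := (_ %/ _)%Z.
have n2 : (2 * n%:Z != 0)%R by lia.
have := divz_eq (2 * u + n%:Z) (2 * n%:Z); rewrite -/q.
have := modz_ge0 (2 * u + n%:Z) n2.
have := ltz_mod (2 * u + n%:Z) n2.
set r := (_ %% _)%Z => h1 h2 h3.
have {}h1 : r < 2 * n%:Z by lia.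
have -> : 4 * (u - q * n%:Z) ^+ 2 = (r - n%:Z) ^+ 2.
  have -> : r - n%:Z = 2 * (u - q * n%:Z) by lia.
  by ring.
nia.
Qed.

(** The coordinates of [a / b], computed from [a] times the conjugate of [b], are rounded to nearest
    integers; the error has norm at most [1/4 + 1/4]. *)
Lemma gint_division (a b : gint) : b != 0 ->
  exists q : gint, (2 * nrm (a - q * b)%R <= nrm b)%N.
Proof.
move=> b0; have nb : (0 < nrm b)%N by rewrite nrm_gt0.
have E := gnormE b; case: a b b0 nb E => [a1 a2] [b1 b2] b0 nb E.
have [q1 h1] := round_div (a1 * b1 + a2 * b2) nb.
have [q2 h2] := round_div (a2 * b1 - a1 * b2) nb.
exists (Complex q1 q2).
set w := (X in nrm X).
suff : 2 * gnorm w * (nrm (Complex b1 b2))%:Z <= (nrm (Complex b1 b2))%:Z ^+ 2.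
  by rewrite gnormE; nia.
rewrite {}/w -E.
move: h1 h2; rewrite -E gintM gintN gintD /gnorm /= => h1 h2.
have -> : 2 * ((a1 - (q1 * b1 - q2 * b2)) ^+ 2 + (a2 - (q1 * b2 + q2 * b1)) ^+ 2)
   * (b1 ^+ 2 + b2 ^+ 2) =
 2 * ((a1 * b1 + a2 * b2 - q1 * (b1 ^+ 2 + b2 ^+ 2)) ^+ 2 +
 (a2 * b1 - a1 * b2 - q2 * (b1 ^+ 2 + b2 ^+ 2)) ^+ 2) by ring.
lia.
Qed.

Lemma gcoprime_bezout (r q : gint) : gcoprime r q ->
  exists u v : gint, r * u + q * v = 1.
Proof.
move=> co.
have [q0|q0] := eqVneq q 0.
  have [||c h] := co r; first by exists 1; rewrite mulr1.
    by exists 0; rewrite mulr0.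
  by exists c, 0; rewrite mulr0 addr0.
(* A nonzero combination of least norm divides every other one, since the remainder of a division by
   it is again a combination. *)
pose P n := `[< exists u v : gint, r * u + q * v != 0 /\ nrm (r * u + q * v)%R = n >].
have exP : exists n, P n.
  exists (nrm q); apply/asboolP; exists 0, 1.
  by rewrite mulr0 mulr1 add0r.
case: (ex_minnP exP) => m /asboolP[u [v [d0 dm]]] mmin.
set d := r * u + q * v in d0 dm.
have dvd x y : gdvd d (r * x + q * y).
  have [c hc] := gint_division (r * x + q * y) d0.
  exists c; apply/eqP; rewrite (mulrC d) -subr_eq0; apply/negPn/negP => n0.
  have hm : (m <= nrm (r * x + q * y - c * d)%R)%N.
    apply: mmin; apply/asboolP; exists (x - c * u), (y - c * v).
    suff -> : r * (x - c * u) + q * (y - c * v) = r * x + q * y - c * d by [].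
    by rewrite /d; ring.
  have : (0 < m)%N by rewrite -dm nrm_gt0.
  move: hc hm; rewrite -/d dm; move: (nrm _) => w; lia.
have [||c h] := co d.
- by have := dvd 1 0; rewrite mulr1 mulr0 addr0.
- by have := dvd 0 1; rewrite mulr1 mulr0 add0r.
by exists (u * c), (v * c); rewrite !mulrA -mulrDl.
Qed.

Lemma gcoprime_bezoutX (r q : gint) n : gcoprime r q ->
  exists u v : gint, r * u + q ^+ n * v = 1.
Proof.
move=> /gcoprime_bezout[u [v h]].
elim: n => [|n [u' [v' h']]]; first by exists 0, 1; ring.
exists (u * (r * u' + q ^+ n * v') + q * v * u'), (v * v').
transitivity ((r * u + q * v) * (r * u' + q ^+ n * v')).
  by rewrite exprS; ring.
by rewrite h h' mulr1.
Qed.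

Lemma gdvd_trans (x y z : gint) : gdvd x y -> gdvd y z -> gdvd x z.
Proof. by move=> [c ->] [d ->]; exists (c * d); rewrite mulrA. Qed.

Lemma gdvd_nrm (d z : gint) : z != 0 -> gdvd d z -> (nrm d <= nrm z)%N.
Proof.
rewrite -nrm_gt0 => h [c E]; move: h; rewrite E nrmM muln_gt0 => /andP[_ h].
by rewrite leq_pmulr.
Qed.

Lemma nrm1_dvd (d : gint) : nrm d = 1%N -> gdvd d 1.
Proof.
move=> h; have d0 : d != 0 by rewrite -nrm_gt0 h.
have [c] := gint_division 1 d0; rewrite h => hc.
have /eqP : nrm (1 - c * d)%R = 0%N by move: (nrm _) hc; lia.
by rewrite nrm_eq0 subr_eq0 => /eqP ->; exists c; rewrite mulrC.
Qed.

(** Squares stand in for discs: character sums over them factor into one-dimensional geometric sums,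
    and they behave well under addition. *)
Definition gboxl (s : nat) : seq gint :=
  [seq Complex (i%:Z - s%:Z) (j%:Z - s%:Z) | i <- iota 0 (2 * s).+1,
                                            j <- iota 0 (2 * s).+1].

Lemma size_gboxl s : size (gboxl s) = ((2 * s).+1 ^ 2)%N.
Proof. by rewrite size_allpairs !size_iota. Qed.

Lemma gboxlP s (z : gint) : (z \in gboxl s) =
  (absz (complex.Re z) <= s)%N && (absz (complex.Im z) <= s)%N.
Proof.
apply/idP/idP.
  case/allpairsP => -[i j] []; rewrite !mem_iota /= => hi hj -> /=; lia.
case: z => a b /= /andP[ha hb]; apply/allpairsP.
exists (absz (a + s%:Z), absz (b + s%:Z)); rewrite !mem_iota /=.
split; [lia|lia|].
congr Complex; lia.
Qed.

Lemma uniq_gboxl s : uniq (gboxl s).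
Proof.
apply: allpairs_uniq; rewrite ?iota_uniq // => -[i j] [i' j'] _ _ /= [h1 h2].
congr pair; lia.
Qed.

Lemma isqrt_ex (n : nat) : exists t, (t ^ 2 <= n)%N /\ (n < t.+1 ^ 2)%N.
Proof.
have exP : exists t, (t ^ 2 <= n)%N by exists 0%N.
have bd t : (t ^ 2 <= n)%N -> (t <= n)%N by case: t => // t; nia.
case: (ex_maxnP exP bd) => t h1 h2; exists t; split=> //.
by rewrite ltnNge; apply/negP => /h2; rewrite ltnn.
Qed.

Lemma gboxl_isqrt t X (z : gint) :
  (X < t.+1 ^ 2)%N -> (nrm z <= X)%N -> z \in gboxl t.
Proof. by rewrite gboxlP /nrm => h1 h2; apply/andP; split; nia. Qed.

(** The disc lies in the square of half-side [t], the integer square root of [X], and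
    [(2 t + 1)^2 <= 8 t^2 + 1]. *)
Lemma size_nrm_le (X : nat) (s : seq gint) :
  uniq s -> {in s, forall z, nrm z <= X}%N -> (size s <= 8 * X + 1)%N.
Proof.
move=> us hs.
have [t [ht1 ht2]] := isqrt_ex X.
have sub : {subset s <= gboxl t} by move=> z /hs; exact: gboxl_isqrt.
apply: leq_trans (uniq_leq_size us sub) _; rewrite size_gboxl; nia.
Qed.

Lemma leq_expn2r (t m n : nat) : (m <= n)%N -> (m ^ t <= n ^ t)%N.
Proof. by case: t => // t h; rewrite leq_exp2r. Qed.

(** * The divisor bound *)

Definition girr (p : gint) : Prop :=
  (1 < nrm p)%N /\ forall d, gdvd d p -> nrm d = 1%N \/ nrm d = nrm p.

Lemma girr_divisor (n : gint) : (1 < nrm n)%N -> exists2 p, girr p & gdvd p n.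
Proof.
move=> n1.
pose P k := `[< exists p, [/\ gdvd p n, (1 < nrm p)%N & nrm p = k] >].
have exP : exists k, P k.
  exists (nrm n); apply/asboolP; exists n; split=> //.
  by exists 1; rewrite mulr1.
case: (ex_minnP exP) => k /asboolP[p [pn p1 pk]] kmin.
exists p => //; split=> // d dp.
have p0 : p != 0 by rewrite -nrm_gt0 ltnW.
have := gdvd_nrm p0 dp; rewrite leq_eqVlt => /orP[/eqP|dlt]; first by right.
left; have d0 : (0 < nrm d)%N.
  case: dp p0 => c ->; rewrite -nrm_gt0 nrmM muln_gt0 => /andP[] //.
have [d1|d1] := leqP (nrm d) 1; first by apply/eqP; rewrite eqn_leq d1 d0.
have : (k <= nrm d)%N.
  apply: kmin; apply/asboolP; exists d; split=> //; exact: gdvd_trans dp pn.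
by rewrite -pk leqNgt dlt.
Qed.

Lemma girr_coprime (p x : gint) : girr p -> ~ gdvd p x -> gcoprime x p.
Proof.
move=> [p1 irr] px d dx dp; have [/nrm1_dvd//|dE] := irr d dp.
case: px; apply: gdvd_trans dx.
have [c pE] := dp.
have [|e he] := @nrm1_dvd c.
  move: dE; rewrite pE nrmM => dE.
  have : (0 < nrm d)%N by move: p1; rewrite pE nrmM; case: (nrm d).
  by move: dE; move: (nrm d) (nrm c) => u v; nia.
by exists e; rewrite pE -mulrA -he mulr1.
Qed.

Lemma girr_valuation (p n : gint) : (1 < nrm p)%N -> n != 0 ->
  exists a m, n = p ^+ a * m /\ ~ gdvd p m.
Proof.
move=> p1; have [k] := ubnP (nrm n); elim: k n => // k IH n hk n0.
have [[c nE]|h] := pselect (gdvd p n); last first.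
  by exists 0%N, n; rewrite expr0 mul1r.
have [||a [m [cE pm]]] := IH c.
- move: hk; rewrite nE nrmM.
  have : (0 < nrm c)%N.
    rewrite nrm_gt0; apply: contraNneq n0 => c0.
    by rewrite nE c0 mulr0.
  move: (nrm p) (nrm c) p1 => u v; nia.
- by apply: contraNneq n0 => c0; rewrite nE c0 mulr0.
by exists a.+1, m; split=> //; rewrite nE cE exprS mulrA.
Qed.

(** The power of [p] in [d] splits off, and it cannot exceed [a] without [p] dividing [m]. The
    cofactor [d'] is coprime to [p], hence divides [m] by a Bezout relation between [d'] and
    [p ^+ (a - j)]. *)
Lemma gdvd_pow_mul (p m d : gint) (a : nat) : girr p -> m != 0 -> ~ gdvd p m ->
  gdvd d (p ^+ a * m) -> exists j d', [/\ d = p ^+ j * d', (j <= a)%N & gdvd d' m].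
Proof.
move=> ip m0 pm [c dc].
have p0 : p != 0 by rewrite -nrm_gt0 ltnW //; case: ip.
have d0 : d != 0.
  have : p ^+ a * m != 0 by rewrite gmulf_eq0 (negPf m0) (negPf (gexpf_neq0 _ p0)).
  by rewrite dc gmulf_eq0 negb_or => /andP[].
have [j [d' [dE pd]]] := girr_valuation ip.1 d0.
have ja : (j <= a)%N.
  rewrite leqNgt; apply/negP => aj; apply: pm.
  exists (p ^+ (j - a).-1 * d' * c).
  apply: (gmulIf (gexpf_neq0 a p0)) => /=.
  rewrite [m * _]mulrC dc dE.
  have -> : j = (a + (1 + (j - a).-1))%N by lia.
  by rewrite !exprD expr1 addKn /=; ring.
exists j, d'; split=> //.
have [u [v h]] := gcoprime_bezoutX (a - j) (girr_coprime ip pd).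
have hc : d' * c = p ^+ (a - j) * m.
  apply: (gmulIf (gexpf_neq0 j p0)) => /=.
  transitivity (d * c); first by rewrite dE; ring.
  by rewrite -dc -{1}(subnKC ja) exprD; ring.
exists (u * m + c * v).
rewrite -{1}[m]mul1r -h mulrDl mulrDr !mulrA hc; ring.
Qed.

(** A divisor is determined by its exponent at [p], one of [a.+1] values, and by its [p]-free part;
    [s'] lists these parts. *)
Lemma size_divisors_pow_mul (p m : gint) (a : nat) (s : seq gint) :
  girr p -> m != 0 -> ~ gdvd p m -> uniq s ->
  (forall d, d \in s -> gdvd d (p ^+ a * m)) ->
  exists s', [/\ uniq s', forall d, d \in s' -> gdvd d m
                & (size s <= a.+1 * size s')%N].
Proof.
move=> ip m0 pm us hs.
have /choice[f hf] : forall d, exists y : nat * gint, d \in s ->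
    [/\ d = p ^+ y.1 * y.2, (y.1 <= a)%N & gdvd y.2 m].
  move=> d; have [ds|] := boolP (d \in s); last by exists (0%N, 0).
  by have [j [d' h]] := gdvd_pow_mul ip m0 pm (hs _ ds); exists (j, d').
exists (undup [seq (f d).2 | d <- s]); split.
- exact: undup_uniq.
- by move=> d; rewrite mem_undup => /mapP[x xs ->]; case: (hf x xs).
rewrite -[a.+1](size_iota 0) -(size_allpairs pair) -(size_map f).
apply: uniq_leq_size.
  rewrite map_inj_in_uniq // => x y xs ys fE.
  by case: (hf x xs) (hf y ys) => -> _ _ [-> _ _]; rewrite fE.
move=> _ /mapP[x xs ->]; case: (hf x xs) => _ h1 h2.
apply/allpairsP; exists (f x); rewrite mem_iota mem_undup; split=> //=.
  exact: map_f.
by case: (f x).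
Qed.

(** If [b] is the quotient of [a] by [t], then [a + 1 <= t (b + 1) <= t 2^b]; take [t]-th powers. *)
Lemma pow_le_exp2 (t a : nat) : (a.+1 ^ t <= t ^ t * 2 ^ a)%N.
Proof.
case: t => [|t]; first by rewrite !expn0 mul1n expn_gt0.
have h : (a.+1 <= t.+1 * 2 ^ (a %/ t.+1))%N.
  have := ltn_expl (a %/ t.+1) (isT : 1 < 2)%N.
  have := divn_eq a t.+1; have := ltn_pmod a (ltn0Sn t).
  move: (a %/ _)%N (a %% _)%N (2 ^ _)%N => b r e h1 h2 h3; nia.
apply: leq_trans (leq_expn2r t.+1 h) _.
by rewrite expnMn -expnM leq_mul2l leq_exp2l // leq_trunc_div orbT.
Qed.

(** The divisor bound with exponent [1 / t], written in integers. All divisors are counted,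
    associates included. *)
Definition few_divisors (t C : nat) (n : gint) : Prop := forall s : seq gint,
  uniq s -> (forall d, d \in s -> gdvd d n) -> (size s ^ t <= C * nrm n)%N.

Lemma few_divisors_pow_mul t C c (p m : gint) a : girr p -> m != 0 -> ~ gdvd p m ->
  (a.+1 ^ t <= c * nrm p ^ a)%N -> few_divisors t C m ->
  few_divisors t (c * C) (p ^+ a * m).
Proof.
move=> ip m0 pm ha hm s us hs.
have [s' [us' hs' le]] := size_divisors_pow_mul ip m0 pm us hs.
apply: leq_trans (leq_expn2r t le) _; rewrite expnMn nrmM nrmX.
have := leq_mul ha (hm s' us' hs'); move/leq_trans; apply.
by rewrite leq_eqVlt; apply/orP; left; apply/eqP; ring.
Qed.

(** An irreducible factor [p] of norm at least [2 ^ t] costs nothing, as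
    [a.+1 ^ t <= 2 ^ (t * a) <= nrm p ^ a]. Each of the finitely many exceptions in [l] costs a
    factor [t ^ t] at most, by [pow_le_exp2]. *)
Lemma few_divisors_except t (l : seq gint) : exists C, forall n, n != 0 ->
  (forall p, girr p -> gdvd p n -> (2 ^ t <= nrm p)%N \/ p \in l) ->
  few_divisors t C n.
Proof.
elim: l => [|p l [C IH]].
  (* An element of norm 1 has at most [8 * 1 + 1] divisors. *)
  exists (9 ^ t)%N => n; have [k] := ubnP (nrm n); elim: k n => // k IH n hk n0 hn.
  have [n1|n1] := leqP (nrm n) 1.
    move=> s us hs.
    have h : (size s <= 8 * 1 + 1)%N.
      apply: size_nrm_le => // d /hs /(gdvd_nrm n0) /leq_trans; exact.
    apply: leq_trans (leq_expn2r t h) _.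
    by rewrite leq_pmulr // nrm_gt0.
  have [p ip pn] := girr_divisor n1.
  have [a [m [nE pm]]] := girr_valuation ip.1 n0.
  have m0 : m != 0 by apply: contraNneq n0 => m0; rewrite nE m0 mulr0.
  have [pt|//] := hn p ip pn.
  have a0 : (0 < a)%N.
    by case: a nE => // nE; case: pm; rewrite nE expr0 mul1r in pn.
  rewrite -[(9 ^ t)%N]mul1n nE; apply: few_divisors_pow_mul => //.
    rewrite mul1n; apply: leq_trans (leq_expn2r a pt).
    by rewrite -expnM mulnC expnM leq_expn2r // ltn_expl.
  apply: IH => //.
    move: hk; rewrite nE nrmM nrmX.
    have : (2 <= nrm p ^ a)%N.
      by apply: leq_trans ip.1 _; rewrite -{1}[nrm p]expn1 leq_pexp2l // ltnW // ip.1.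
    have : (0 < nrm m)%N by rewrite nrm_gt0.
    move: (_ ^ a)%N (nrm m) => u v; nia.
  move=> q iq qm; apply: hn => //; apply: gdvd_trans qm _.
  by exists (p ^+ a); rewrite nE mulrC.
have [ip|ip] := pselect (girr p); last first.
  exists C => n n0 hn; apply: IH => // q iq qn.
  have [|] := hn q iq qn; first by left.
  by rewrite inE => /orP[/eqP qp|]; [case: ip; rewrite -qp | right].
exists (t ^ t * C)%N => n n0 hn.
have [a [m [nE pm]]] := girr_valuation ip.1 n0.
have m0 : m != 0 by apply: contraNneq n0 => m0; rewrite nE m0 mulr0.
rewrite nE; apply: few_divisors_pow_mul => //.
  by apply: leq_trans (pow_le_exp2 t a) _; rewrite leq_mul2l leq_expn2r ?orbT // ip.1.
apply: IH => // q iq qm; have [||] := hn q iq.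
- by apply: gdvd_trans qm _; exists (p ^+ a); rewrite nE mulrC.
- by left.
by rewrite inE => /orP[/eqP qp|]; [case: pm; rewrite -qp | right].
Qed.

Lemma divisor_bound t : exists C, forall n, n != 0 -> few_divisors t C n.
Proof.
have [C h] := few_divisors_except t (gboxl (2 ^ t)).
exists C => n n0; apply: h => // p _ _.
have [|lt] := leqP (2 ^ t) (nrm p); first by left.
right; rewrite gboxlP; move: lt; rewrite /nrm; case: p => x y /=.
move: (2 ^ t)%N => w; nia.
Qed.

(** * Weyl differencing *)

Fixpoint iter_diff (R : comNzRingType) (hs : seq R) (f : R -> R) (x : R) : R :=
  if hs is h :: hs' then iter_diff hs' (fun y => f (y + h) - f y) x else f x.

Lemma eq_iter_diff (R : comNzRingType) (hs : seq R) (f g : R -> R) x :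
  f =1 g -> iter_diff hs f x = iter_diff hs g x.
Proof.
elim: hs f g => [|h hs IH] f g fg //=; apply: IH => y; by rewrite !fg.
Qed.

Lemma iter_diff_sum (R : comNzRingType) (hs : seq R) n (c : 'I_n -> R)
    (f : 'I_n -> R -> R) x :
  iter_diff hs (fun y => \sum_(j < n) c j * f j y) x =
  \sum_(j < n) c j * iter_diff hs (f j) x.
Proof.
elim: hs f => [|h hs IH] f //=; rewrite -IH; apply: eq_iter_diff => y.
by rewrite -sumrB; apply: eq_bigr => j _; rewrite mulrBr.
Qed.

(** The binomial theorem for [(y + h)^n - y^n]: the term of degree [n] cancels, so each difference
    lowers the degree. *)
Lemma iter_diff_powE (R : comNzRingType) (h : R) (hs : seq R) n x :
  iter_diff (h :: hs) (fun y => y ^+ n) x =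
  \sum_(j < n) (h ^+ (n - j) *+ 'C(n, j)) * iter_diff hs (fun y => y ^+ j) x.
Proof.
rewrite -iter_diff_sum /=; apply: eq_iter_diff => y.
rewrite addrC [y + h]addrC exprDn big_ord_recr /= subnn binn expr0 mul1r mulr1n.
rewrite addrCA addNr addr0; apply: eq_bigr => j _; by rewrite mulrnAl.
Qed.

Lemma iter_diff_pow_gt (R : comNzRingType) (hs : seq R) n x :
  (n < size hs)%N -> iter_diff hs (fun y => y ^+ n) x = 0.
Proof.
elim: hs n => [|h hs IH] n // hn; rewrite iter_diff_powE big1 // => j _.
by rewrite IH ?mulr0 // (leq_trans (ltn_ord j)).
Qed.

Lemma iter_diff_pow_eq (R : comNzRingType) (hs : seq R) x :
  iter_diff hs (fun y => y ^+ size hs) x = (size hs)`!%:R * \prod_(h <- hs) h.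
Proof.
elim: hs => [|h hs IH]; first by rewrite big_nil mulr1.
rewrite iter_diff_powE big_ord_recr /= big1 ?add0r => [|j _]; last first.
  by rewrite iter_diff_pow_gt ?mulr0.
rewrite subSnn expr1 binSn IH big_cons factS natrM -mulr_natl.
ring.
Qed.

(** In the binomial expansion for [h :: hs], only the two top degrees survive the differences along
    [hs]: one gives the factor from the induction hypothesis, the other the new summand [h]. The
    factor 2 clears the denominator of the binomial coefficient. *)
Lemma iter_diff_pow_pred (R : comNzRingType) (hs : seq R) x :
  2 * iter_diff hs (fun y => y ^+ (size hs).+1) x =
  (size hs).+1`!%:R * \prod_(h <- hs) h * (2 * x + \sum_(h <- hs) h).
Proof.
elim: hs => [|h hs IH]; first by rewrite !big_nil !mulr1 addr0 mul1r.
rewrite iter_diff_powE /= big_ord_recr big_ord_recr /= big1 ?add0r; last first.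
  by move=> j _; rewrite iter_diff_pow_gt ?mulr0.
rewrite mulrDr iter_diff_pow_eq [2 * (_ * iter_diff _ _ _)]mulrCA IH.
rewrite subSnn expr1.
have -> : ((size hs).+2 - size hs = 2)%N by lia.
have b1 : ('C((size hs).+2, (size hs).+1) = (size hs).+2)%N by rewrite binSn.
have b2 : ('C((size hs).+2, size hs)%:R * 2 : R) = ((size hs).+2 * (size hs).+1)%:R.
  have -> : 'C((size hs).+2, size hs) = 'C((size hs).+2, 2).
    by rewrite -bin_sub ?leqW //; congr binomial; lia.
  rewrite -natrM; congr (_%:R).
  by have := bin_ffact (size hs).+2 2; rewrite !ffactnSr ffactn0 mul1n subn0 subn1 => <-.
rewrite b1 !big_cons -[_ ^+ 2 *+ _]mulr_natl -[h *+ _]mulr_natl.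
have -> : 2 * ('C((size hs).+2, size hs)%:R * h ^+ 2 *
     ((size hs)`!%:R * (\prod_(h <- hs) h))) =
  ('C((size hs).+2, size hs)%:R * 2) * h ^+ 2 *
     ((size hs)`!%:R * (\prod_(h <- hs) h)) by ring.
rewrite b2 !factS !natrM; ring.
Qed.

(** * Cubes in a set and Cauchy's inequality *)

Definition shift_cap (A : seq gint) (h : gint) := [seq y <- A | y + h \in A].

(** Each element is a list of [m] steps with a base point such that all [2 ^ m] vertices lie in [A];
    zero steps are allowed. Intersecting [A] with its translate by [- h] makes room for the step
    [h]. *)
Fixpoint cubes (H : seq gint) (m : nat) (A : seq gint) : seq (seq gint * gint) :=
  if m is m'.+1 then
    [seq (h :: c.1, c.2) | h <- H, c <- cubes H m' (shift_cap A h)]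
  else [seq ([::], x) | x <- A].

Lemma size_cubesS (H : seq gint) m A :
  size (cubes H m.+1 A) = (\sum_(h <- H) size (cubes H m (shift_cap A h)))%N.
Proof. by rewrite /= size_allpairs_dep sumnE big_map. Qed.

Lemma sum_sqr_le (I : Type) (s : seq I) (f : I -> nat) :
  ((\sum_(i <- s) f i) ^ 2 <= size s * \sum_(i <- s) f i ^ 2)%N.
Proof.
have aux a (t : seq I) : (2 * a * (\sum_(i <- t) f i)
   <= size t * a ^ 2 + \sum_(i <- t) f i ^ 2)%N.
  elim: t => [|i t IH]; first by rewrite !big_nil muln0.
  rewrite !big_cons /=; have := (nat_Cauchy a (f i)).1.
  move: (\sum_(_ <- _) _)%N (\sum_(_ <- _) _)%N IH => S T; nia.
elim: s => [|i s IH]; first by rewrite !big_nil.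
rewrite !big_cons /=; have := aux (f i) s.
move: (\sum_(_ <- _) _)%N (\sum_(_ <- _) _)%N IH => S T; nia.
Qed.

Definition has_differences (H A : seq gint) :=
  forall x y, x \in A -> y \in A -> x - y \in H.

Lemma has_differences_cap (H A : seq gint) h :
  has_differences H A -> has_differences H (shift_cap A h).
Proof. by move=> hA x y; rewrite !mem_filter => /andP[_ ?] /andP[_ ?]; exact: hA. Qed.

Lemma cubes1_ge (H A : seq gint) : uniq A -> has_differences H A ->
  (size A ^ 2 <= size (cubes H 1 A))%N.
Proof.
move=> uA hA; rewrite -mulnn -(size_allpairs (fun x y => ([:: x - y], y))).
apply: uniq_leq_size.
  apply: allpairs_uniq => // -[x y] [x' y'] _ _ /= [] e1 e2; subst y'.
  by move/eqP: e1; rewrite (inj_eq (addIr _)) => /eqP ->.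
move=> _ /allpairsP[[x y] [hx hy ->]] /=.
apply/allpairsPdep; exists (x - y), ([::], y); split=> //=.
  exact: hA.
by apply: map_f; rewrite mem_filter addrC subrK hx hy.
Qed.

(** Cauchy's inequality over the first step, then induction inside each [shift_cap A h]. At the
    bottom, a pair of points of [A] is a cube given by a difference and an endpoint. *)
Lemma sqr_cubes_le (H : seq gint) m A : uniq A -> has_differences H A ->
  (size (cubes H m A) ^ 2 <= size H ^ m * size (cubes H m.+1 A))%N.
Proof.
elim: m A => [|m IH] A uA hA.
  by rewrite expn0 mul1n size_map; exact: cubes1_ge.
rewrite size_cubesS size_cubesS; apply: leq_trans (sum_sqr_le _ _) _.
rewrite expnS -mulnA leq_mul2l big_distrr /=; apply/orP; right.
apply: leq_sum => h _; apply: IH; first exact: filter_uniq.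
exact: has_differences_cap.
Qed.

(** In terms of densities: the proportion of cubes among [size H ^ m.+1] candidates is at least the
    [2 ^ m]-th power of [size A / size H]. Squaring the bound for [m] and applying [sqr_cubes_le]
    gives the next one. *)
Lemma energy_bound (H : seq gint) m A : (0 < size H)%N -> uniq A ->
  has_differences H A ->
  (size A ^ (2 ^ m) * size H ^ m.+1 <= size H ^ (2 ^ m) * size (cubes H m A))%N.
Proof.
move=> H0 uA hA; elim: m => [|m IH].
  by rewrite !expn1 mulnC leq_mul2l size_map leqnn orbT.
have Hm : (0 < size H ^ m)%N by rewrite expn_gt0 H0.
rewrite -(leq_pmul2l Hm).
have IH2 := leq_mul IH IH; have S := sqr_cubes_le m uA hA.
have -> : (2 ^ m.+1 = 2 ^ m * 2)%N by rewrite expnSr.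
rewrite !expnM [(size H ^ m.+2)%N]expnS; move: IH2 S; rewrite [(size H ^ m.+1)%N]expnS.
move: (size (cubes H m.+1 A)) (size (cubes H m A)) => E' E.
move: (size A ^ 2 ^ m)%N (size H ^ 2 ^ m)%N (size H ^ m)%N => a b c h1 h2.
apply: (@leq_trans (a * (size H * c) * (a * (size H * c)))%N).
  by rewrite leq_eqVlt; apply/orP; left; apply/eqP; ring.
apply: leq_trans h1 _.
apply: (@leq_trans (b ^ 2 * E ^ 2)%N).
  by rewrite leq_eqVlt; apply/orP; left; apply/eqP; ring.
apply: (@leq_trans (b ^ 2 * (c * E'))%N); first by rewrite leq_mul2l h2 orbT.
by rewrite leq_eqVlt; apply/orP; left; apply/eqP; ring.
Qed.

Lemma uniq_cubes (H : seq gint) m A : uniq H -> uniq A -> uniq (cubes H m A).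
Proof.
move=> uH; elim: m A => [|m IH] A uA /=.
  by rewrite map_inj_uniq // => x y [].
apply: allpairs_uniq_dep => //.
  by move=> h _; apply: IH; exact: filter_uniq.
move=> [h [c x]] [h' [c' x']] /= _ _ [] -> -> ->; by [].
Qed.

Lemma mem_cubes (H : seq gint) m A c : c \in cubes H m A ->
  [/\ size c.1 = m, {subset c.1 <= H} & c.2 \in A].
Proof.
elim: m A c => [|m IH] A c /=.
  by case/mapP => x hx -> /=.
case/allpairsPdep => h [c' [hh /IH[h1 h2 h3] ->]] /=.
split; first by rewrite h1.
  by move=> y; rewrite inE => /orP[/eqP->|/h2].
by move: h3; rewrite mem_filter => /andP[].
Qed.

(* [r * z / v] lies within [sqrt (T / nrm v)] of a Gaussian integer. *)
Definition near (r v : gint) (T : nat) (z : gint) : Prop :=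
  exists m w, r * z = w * v + m /\ (nrm m <= T)%N.

Lemma near_sub r v T y z : near r v T y -> near r v T z -> near r v (4 * T) (y - z).
Proof.
move=> [m [w [e h]]] [m' [w' [e' h']]]; exists (m - m'), (w - w').
split; first by rewrite mulrBr e e'; ring.
apply: leq_trans (nrmB_le _ _) _; move: (nrm m) (nrm m') h h' => a b; lia.
Qed.

Lemma near_double r v T z : near r v T z -> near r v (4 * T) (2 * z).
Proof.
move=> [m [w [e h]]]; exists (2 * m), (2 * w).
split; first by rewrite mulrCA e; ring.
by rewrite nrmM leq_mul2l h orbT.
Qed.

(** Each difference costs a factor 4, because the norm of a difference is at most twice the sum of
    the norms. *)
Lemma near_cubes (H : seq gint) r v m : forall A T (f : gint -> gint) c,
  (forall x, x \in A -> near r v T (f x)) -> c \in cubes H m A ->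
  near r v (4 ^ m * T) (iter_diff c.1 f c.2).
Proof.
elim: m => [|m IH] A T f c hA /=.
  by case/mapP => x hx -> /=; rewrite mul1n; exact: hA.
case/allpairsPdep => h [c' [hh hc ->]] /=.
rewrite expnSr -mulnA; apply: (IH (shift_cap A h)) => // x.
rewrite mem_filter => /andP[h1 h2]; apply: near_sub; exact: hA.
Qed.

Lemma size_fibers (I J : eqType) (f : I -> J) (s : seq I) K :
  (forall y, y \in [seq f x | x <- s] -> (count (fun x => f x == y) s <= K)%N) ->
  (size s <= size (undup [seq f x | x <- s]) * K)%N.
Proof.
move=> h; set t := undup _.
have ht : forall y, y \in t -> (count (fun x => f x == y) s <= K)%N.
  by move=> y; rewrite mem_undup; exact: h.
have : all (fun x => f x \in t) s.
  by apply/allP => x hx; rewrite mem_undup map_f.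
elim: (t) (s) ht => [|y t' IH] s' hh.
  by case: s' {hh} => //= x s' /andP[].
move=> /allP al; rewrite -(count_predC (fun x => f x == y) s') mulSn leq_add ?hh ?mem_head //.
rewrite -size_filter; apply: IH.
  move=> z hz; apply: leq_trans (hh z _); last by rewrite inE hz orbT.
  by rewrite count_filter; apply: sub_count => x /= /andP[].
apply/allP => x; rewrite mem_filter => /andP[/= n /al]; by rewrite inE (negPf n).
Qed.

(* Since [r] is invertible modulo [v], the residue of [r * l] determines that of [l]. *)
Lemma size_near (r u v w : gint) (T B : nat) (L : seq gint) : v != 0 ->
  r * u + v * w = 1 -> uniq L ->
  (forall l, l \in L -> near r v T l) ->
  (forall l, l \in L -> nrm l <= B * nrm v)%N ->
  (size L <= (8 * T + 1) * (8 * (4 * B) + 1))%N.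
Proof.
move=> v0 bez uL hL hB.
have /choice[f hf] : forall l, exists m, l \in L ->
    (nrm m <= T)%N /\ exists w', r * l = w' * v + m.
  move=> l; have [lL|] := boolP (l \in L); last by exists 0.
  by have [m [w' [e h]]] := hL l lL; exists m => _; split=> //; exists w'.
(* The list is split by the remainder [f l], which takes at most [8 * T + 1] values. *)
apply: leq_trans (@size_fibers _ _ f L (8 * (4 * B) + 1) _) _; last first.
  rewrite leq_mul2r; apply/orP; right; apply: size_nrm_le; first exact: undup_uniq.
  by move=> z; rewrite mem_undup => /mapP[l lL ->]; case: (hf l lL).
move=> _ /mapP[l0 l0L ->]; rewrite -size_filter; set s := seq.filter _ _.
have hs l : l \in s -> l \in L /\ f l = f l0.
  by rewrite mem_filter => /andP[/eqP].
have /choice[g hg] : forall l, exists c, l \in s -> l = l0 + v * c.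
  move=> l; have [/hs [lL fl]|] := boolP (l \in s); last by exists 0.
  have [_ [w1 e1]] := hf l lL; have [_ [w0 e0]] := hf l0 l0L.
  (* Equal remainders give [r (l - l0) = v (w1 - w0)]; multiplying [l - l0] by [r u + v w = 1]
     exhibits it as a multiple of [v]. *)
  exists (u * (w1 - w0) + w * (l - l0)) => _.
  have e2 : r * (l - l0) = v * (w1 - w0) by rewrite mulrBr e1 e0 fl; ring.
  have -> : l0 + v * (u * (w1 - w0) + w * (l - l0)) =
     l0 + (u * (v * (w1 - w0)) + v * w * (l - l0)) by ring.
  rewrite -e2.
  have -> : l0 + (u * (r * (l - l0)) + v * w * (l - l0)) =
     l0 + (r * u + v * w) * (l - l0) by ring.
  by rewrite bez mul1r addrC subrK.
rewrite -(size_map g); apply: size_nrm_le.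
  rewrite map_inj_in_uniq ?filter_uniq // => x y xs ys gE.
  by rewrite (hg x xs) (hg y ys) gE.
move=> _ /mapP[l ls ->].
have nv : (0 < nrm v)%N by rewrite nrm_gt0.
rewrite -(leq_pmul2r nv) -nrmM.
have -> : g l * v = l - l0 by rewrite {2}(hg l ls); ring.
apply: leq_trans (nrmB_le _ _) _.
have := hB l (hs l ls).1; have := hB l0 l0L.
move: (nrm l) (nrm l0) (nrm v) => a b c; nia.
Qed.

(** * Words of factors and the count of cubes *)

Fixpoint words (T : eqType) (S : seq T) (n : nat) : seq (seq T) :=
  if n is n'.+1 then [seq x :: w | x <- S, w <- words S n'] else [:: [::]].

Lemma size_words (T : eqType) (S : seq T) n : size (words S n) = (size S ^ n)%N.
Proof. by elim: n => //= n IH; rewrite size_allpairs IH expnS. Qed.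

Lemma mem_words (T : eqType) (S : seq T) n w :
  size w = n -> {subset w <= S} -> w \in words S n.
Proof.
elim: n w => [|n IH] [|x w] //= [sw] hw; apply/allpairsP; exists (x, w).
split=> //=; first by apply: hw; rewrite mem_head.
by apply: IH => // y yw; apply: hw; rewrite inE yw orbT.
Qed.

Fixpoint words_with (T : eqType) (z : T) (S : seq T) (n : nat) : seq (seq T) :=
  if n is n'.+1 then [seq z :: w | w <- words S n'] ++
    [seq x :: w | x <- S, w <- words_with z S n'] else [::].

(** There are [n] places for [z] and the other letters are free; the factor [size S] on the left
    avoids the exponent [n - 1]. *)
Lemma size_words_with (T : eqType) (z : T) (S : seq T) n :
  (size S * size (words_with z S n) <= n * size S ^ n)%N.
Proof.
elim: n => [|n IH] /=; first by rewrite muln0.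
rewrite size_cat size_map size_words size_allpairs expnS mulnDr mulSn leq_add //.
by rewrite mulnCA leq_mul2l IH orbT.
Qed.

Lemma mem_words_with (T : eqType) (z : T) (S : seq T) n w :
  size w = n -> {subset w <= S} -> z \in w -> w \in words_with z S n.
Proof.
elim: n w => [|n IH] [|x w] //= [sw] hw; rewrite inE mem_cat => /orP[/eqP<-|zw].
  by rewrite map_f // mem_words // => y yw; apply: hw; rewrite inE yw orbT.
apply/orP; right; apply/allpairsP; exists (x, w).
split=> //=; first by apply: hw; rewrite mem_head.
by apply: IH => // y yw; apply: hw; rewrite inE yw orbT.
Qed.

Lemma size_divisor_words (n : nat) (l : gint) (D : nat) (V : seq (seq gint)) :
  (forall s : seq gint, uniq s -> (forall d, d \in s -> gdvd d l) -> size s <= D)%N ->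
  uniq V -> (forall w, w \in V -> size w = n /\ forall d, d \in w -> gdvd d l) ->
  (size V <= D ^ n)%N.
Proof.
move=> hD uV hV; pose S := undup (flatten V).
have hS : (size S <= D)%N.
  apply: hD; first exact: undup_uniq.
  by move=> d; rewrite mem_undup => /flattenP[w wV dw]; exact: (hV w wV).2.
apply: leq_trans (leq_expn2r n hS); rewrite -size_words.
apply: uniq_leq_size => // w wV; apply: mem_words; first exact: (hV w wV).1.
by move=> d dw; rewrite mem_undup; apply/flattenP; exists w.
Qed.

Lemma nrm_box (s : nat) (z : gint) : z \in gboxl s -> (nrm z <= 2 * s ^ 2)%N.
Proof. by rewrite gboxlP /nrm => /andP[]; nia. Qed.

Lemma gboxl_add (s t : nat) (x y : gint) :
  x \in gboxl s -> y \in gboxl t -> x + y \in gboxl (s + t).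
Proof.
case: x y => a b [c d]; rewrite gintD !gboxlP /= => /andP[? ?] /andP[? ?]; lia.
Qed.

Lemma gboxl_opp (s : nat) (x : gint) : x \in gboxl s -> - x \in gboxl s.
Proof. by case: x => a b; rewrite gintN !gboxlP /= !abszN. Qed.

Lemma gboxl_sum (s : nat) (hs : seq gint) :
  {subset hs <= gboxl s} -> \sum_(h <- hs) h \in gboxl (size hs * s).
Proof.
elim: hs => [|h hs IH] hh; first by rewrite big_nil gboxlP.
rewrite big_cons mulSn gboxl_add ?hh ?mem_head // IH // => y yh.
by rewrite hh // inE yh orbT.
Qed.

Lemma nrm_prod_le (X : nat) (w : seq gint) :
  (forall d, d \in w -> nrm d <= X)%N -> (nrm (\prod_(d <- w) d)%R <= X ^ size w)%N.
Proof.
elim: w => [|d w IH] h; first by rewrite big_nil.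
rewrite big_cons nrmM expnS leq_mul ?h ?mem_head // IH // => y yw.
by rewrite h // inE yw orbT.
Qed.

Lemma gdvd_prod (w : seq gint) (c d : gint) :
  d \in w -> gdvd d (c * \prod_(x <- w) x).
Proof.
move=> dw; rewrite (big_rem d) //=; exists (c * \prod_(x <- rem d w) x); ring.
Qed.

Lemma gint_natr n : (n%:R : gint) = Complex n%:Z 0.
Proof.
elim: n => // n IH; rewrite -natr1 IH.
have -> : (1 : gint) = Complex 1 0 by [].
by rewrite gintD addr0; congr Complex; lia.
Qed.

Lemma nrm_natr n : nrm (n%:R : gint) = (n ^ 2)%N.
Proof. by rewrite gint_natr /nrm /=; lia. Qed.

Lemma natr_neq0 n : (0 < n)%N -> (n%:R : gint) != 0.
Proof. by rewrite -nrm_gt0 nrm_natr expn_gt0 => ->. Qed.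

Lemma prod_gint_neq0 (w : seq gint) : 0 \notin w -> \prod_(d <- w) d != 0.
Proof.
elim: w => [|d w IH]; first by rewrite big_nil -nrm_gt0.
by rewrite inE negb_or big_cons gmulf_eq0 negb_or eq_sym => /andP[-> /IH].
Qed.

(** The factors of the iterated difference apart from the factorial, by [iter_diff_pow_pred]. The
    word determines the cube, so cubes can be counted as words. *)
Definition cube_word (c : seq gint * gint) : seq gint :=
  (2 * c.2 + \sum_(h <- c.1) h) :: c.1.

Lemma cube_word_inj : injective cube_word.
Proof.
move=> [hs x] [hs' x'] [/= e1 e2]; subst hs'; move: e1 => /addIr e.
congr pair; apply: (@gmulIf 2); first exact: (@natr_neq0 2).
by rewrite /= mulrC e mulrC.
Qed.

Lemma cube_word_diff m (c : seq gint * gint) : size c.1 = m ->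
  m.+1`!%:R * \prod_(d <- cube_word c) d = 2 * iter_diff c.1 (fun y => y ^+ m.+1) c.2.
Proof. by move=> <-; rewrite iter_diff_pow_pred big_cons; ring. Qed.

Lemma mem_cube_word t m (A : seq gint) c : {subset A <= gboxl t} ->
  c \in cubes (gboxl (2 * t)) m A ->
  size (cube_word c) = m.+1 /\ {subset cube_word c <= gboxl (2 * t * m.+1)}.
Proof.
move=> At /mem_cubes[sc hc xc]; split; first by rewrite /= sc.
move=> y; rewrite inE => /orP[/eqP->|/hc]; last first.
  by rewrite !gboxlP => /andP[]; nia.
have -> : (2 * t * m.+1 = t + t + m * (2 * t))%N by lia.
rewrite -sc mulr2n mulrDl mul1r.
by apply: gboxl_add (gboxl_sum hc); apply: gboxl_add; exact: At.
Qed.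

(* The degenerate cubes are those with a vanishing step or a vanishing linear factor. *)
Lemma size_cubes_le (m t T D B : nat) (r u v w : gint) (A : seq gint) :
  v != 0 -> r * u + v * w = 1 -> uniq A -> {subset A <= gboxl t} ->
  (forall x, x \in A -> near r v T (x ^+ m.+1)) ->
  (m.+1`! ^ 2 * (2 * (2 * t * m.+1) ^ 2) ^ m.+1 <= B * nrm v)%N ->
  (forall (l : gint) s, l != 0 -> (nrm l <= B * nrm v)%N -> uniq s ->
     (forall d, d \in s -> gdvd d l) -> (size s <= D)%N) ->
  (size (cubes (gboxl (2 * t)) m A) <= m.+1 * ((4 * t * m.+1).+1 ^ 2) ^ m +
    (8 * (4 ^ m.+1 * T) + 1) * (8 * (4 * B) + 1) * D ^ m.+1)%N.
Proof.
move=> v0 bez uA At hA hB hD.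
set H := gboxl _; set H' := gboxl (2 * t * m.+1).
set V := [seq cube_word c | c <- cubes H m A].
have uV : uniq V by rewrite map_inj_uniq ?uniq_cubes ?uniq_gboxl //; exact: cube_word_inj.
have hV x : x \in V -> [/\ size x = m.+1, {subset x <= H'}
    & near r v (4 ^ m.+1 * T) (m.+1`!%:R * \prod_(d <- x) d)].
  case/mapP => c hc ->; have [h1 h2] := mem_cube_word At hc; split=> //.
  rewrite cube_word_diff; last by case/mem_cubes: hc.
  by rewrite expnS -mulnA; apply: near_double; exact: near_cubes hA hc.
rewrite -(size_map cube_word) -/V.
rewrite -(count_predC (fun x : seq gint => 0 \in x) V) -!size_filter.
apply: leq_add.
  have sH : size H' = ((4 * t * m.+1).+1 ^ 2)%N.
    by rewrite size_gboxl; congr (_ ^ 2)%N; lia.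
  have H0 : (0 < size H')%N by rewrite sH expn_gt0.
  rewrite -sH -(leq_pmul2l H0) mulnCA -expnS.
  apply: leq_trans (size_words_with 0 H' m.+1); rewrite leq_mul2l.
  apply/orP; right; apply: uniq_leq_size; first exact: filter_uniq.
  move=> x; rewrite mem_filter => /andP[x0 /hV[h1 h2 _]].
  exact: mem_words_with.
set V1 := seq.filter _ _; pose f (x : seq gint) := m.+1`!%:R * \prod_(d <- x) d.
have hV1 x : x \in V1 -> x \in V /\ f x != 0.
  rewrite mem_filter => /andP[/= x0 xV]; split=> //.
  by rewrite gmulf_eq0 negb_or natr_neq0 ?fact_gt0 // prod_gint_neq0.
have hf x : x \in V1 -> (nrm (f x) <= B * nrm v)%N.
  move=> /hV1[/hV[sx xH _] _]; apply: leq_trans hB.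
  rewrite nrmM nrm_natr leq_mul2l; apply/orP; right.
  by rewrite -sx; apply: nrm_prod_le => d /xH /nrm_box; rewrite sx.
(* The values of the product are counted by [size_near]; over each value there are at most
   [D ^ m.+1] words, since every letter divides it. *)
apply: leq_trans (@size_fibers _ _ f V1 (D ^ m.+1) _) _; last first.
  rewrite leq_mul2r; apply/orP; right.
  apply: size_near v0 bez (undup_uniq _) _ _.
    by move=> l; rewrite mem_undup => /mapP[x /hV1[/hV[_ _ h] _] ->].
  by move=> l; rewrite mem_undup => /mapP[x /hf h ->].
move=> _ /mapP[x xV1 ->]; rewrite -size_filter.
apply: (@size_divisor_words _ (f x)).
- by move=> s; apply: hD; [exact: (hV1 x xV1).2 | exact: hf].
- by rewrite !filter_uniq.
move=> y; rewrite mem_filter => /andP[/eqP fy yV1].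
have [yV _] := hV1 y yV1; have [sy _ _] := hV y yV.
by split=> // d dy; rewrite -fy; exact: gdvd_prod.
Qed.

(** The lower bound [energy_bound] for the number of cubes meets the upper bound [size_cubes_le], in
    a square of half-side the integer square root of [Q]. *)
Lemma weyl_count m : exists C, forall (Q T D : nat) (r u v w : gint) (A : seq gint),
  (0 < Q)%N -> v != 0 -> r * u + v * w = 1 -> uniq A ->
  (forall x, x \in A -> nrm x <= Q)%N -> (Q ^ m.+1 <= 2 ^ m.+1 * nrm v)%N ->
  (nrm v <= Q ^ m.+1)%N ->
  (forall x, x \in A -> near r v T (x ^+ m.+1)) ->
  (forall (l : gint) s, l != 0 -> (nrm l <= C * Q ^ m.+1)%N -> uniq s ->
     (forall d, d \in s -> gdvd d l) -> (size s <= D)%N) ->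
  (size A ^ (2 ^ m) * Q ^ m.+1 <= C * Q ^ (2 ^ m) * (Q ^ m + (1 + T) * D ^ m.+1))%N.
Proof.
(* [B] bounds the norm of a product relative to [nrm v], by [t ^ 2 <= Q] and
   [Q ^ m.+1 <= 2 ^ m.+1 * nrm v]. The constants [25] come from [(4 t + 1)^2 <= 25 t^2]. Adding [B]
   to the final constant lets the divisor hypothesis cover all these products. *)
pose B := (m.+1`! ^ 2 * (8 * m.+1 ^ 2) ^ m.+1 * 2 ^ m.+1)%N.
pose C4 := (m.+1 * (25 * m.+1 ^ 2) ^ m + 8 * 4 ^ m.+1 * (8 * (4 * B) + 1))%N.
exists (B + 25 ^ (2 ^ m) * C4)%N => Q T D r u v w A Q0 v0 bez uA AQ Qv vQ hA hD.
have [t [t1 t2]] := isqrt_ex Q.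
have t0 : (0 < t)%N by case: t t2 {t1} => //; case: Q Q0 {AQ Qv vQ hD} => //; lia.
have At : {subset A <= gboxl t} by move=> x /AQ; exact: gboxl_isqrt.
have hB : (m.+1`! ^ 2 * (2 * (2 * t * m.+1) ^ 2) ^ m.+1 <= B * nrm v)%N.
  rewrite /B; move: (m.+1`! ^ 2)%N => fk; rewrite -!mulnA leq_mul2l; apply/orP; right.
   apply: leq_trans _ (leq_mul (leqnn _) Qv); rewrite -expnMn leq_expn2r //.
  by move: t1; move: (m.+1) => k; rewrite !expnMn; move: (k ^ 2)%N => k2; nia.
have := @size_cubes_le m t T D B r u v w A v0 bez uA At hA hB.
have {hD} h2 : forall (l : gint) s, l != 0 -> (nrm l <= B * nrm v)%N -> uniq s ->
     (forall d, d \in s -> gdvd d l) -> (size s <= D)%N.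
  move=> l s l0 hl; apply: hD => //; apply: leq_trans hl _.
  apply: leq_mul => //; exact: leq_addr.
move/(_ h2) => {h2} hE.
have hs : (size (gboxl (2 * t)) = (4 * t).+1 ^ 2)%N.
  by rewrite size_gboxl; congr (_ ^ 2)%N; lia.
have hH : (0 < size (gboxl (2 * t)))%N by rewrite hs expn_gt0.
have hd : has_differences (gboxl (2 * t)) A.
  move=> x y /At hx /At hy; rewrite mul2n -addnn.
  by apply: gboxl_add => //; exact: gboxl_opp.
have en := energy_bound m hH uA hd.
have QH : (Q <= size (gboxl (2 * t)))%N by rewrite hs; clear -t2; nia.
have HQ : (size (gboxl (2 * t)) <= 25 * Q)%N by rewrite hs; clear -t1 t0; nia.
apply: leq_trans (leq_mul (leqnn _) (leq_expn2r m.+1 QH)) _.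
apply: leq_trans en _.
have hE' : (size (cubes (gboxl (2 * t)) m A) <= C4 * (Q ^ m + (1 + T) * D ^ m.+1))%N.
  apply: leq_trans hE _.
  have e1 : (((4 * t * m.+1).+1 ^ 2) ^ m <= (25 * m.+1 ^ 2) ^ m * Q ^ m)%N.
    rewrite -expnMn leq_expn2r //.
    have h : ((4 * t * m.+1).+1 <= 5 * t * m.+1)%N by clear -t0; nia.
    apply: leq_trans (leq_expn2r 2 h) _.
    have -> : ((5 * t * m.+1) ^ 2 = 25 * m.+1 ^ 2 * t ^ 2)%N by ring.
    by rewrite leq_mul2l t1 orbT.
  move: e1; rewrite /C4; move: ((_ ^ 2) ^ m)%N => a.
  have y0 : (0 < 4 ^ m.+1)%N by rewrite expn_gt0.
  move: ((25 * _ ^ 2) ^ m)%N (Q ^ m)%N (D ^ _)%N (8 * (4 * B) + 1)%N (4 ^ _)%N y0.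
  move=> b q d x y y0 h.
  apply: (@leq_trans (m.+1 * (b * q) + 8 * y * x * ((1 + T) * d))%N); last first.
    by rewrite mulnDr mulnA leq_add // leq_mul2r ?leq_addr ?leq_addl orbT.
  apply: leq_add; first by rewrite leq_mul2l h orbT.
  have -> : (8 * y * x * ((1 + T) * d) = (8 * y * (1 + T)) * x * d)%N by ring.
  rewrite !leq_mul2r; apply/orP; right; apply/orP; right; clear -y0; nia.
apply: leq_trans (leq_mul (leq_expn2r _ HQ) hE') _.
rewrite expnMn; move: (Q ^ m + _)%N => Z.
apply: (@leq_trans (25 ^ 2 ^ m * C4 * Q ^ 2 ^ m * Z)%N); first by apply: eq_leq; ring.
by rewrite !leq_mul2r leq_addl !orbT.
Qed.

(** Here [a] is the number of distinct denominators [x.1] occurring in [P]. The second inequality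
    bounds the numerators sharing a denominator, the third is [weyl_count]. *)
Lemma block_multiplicity m : exists C, forall (Q T D : nat) (q0 r0 : gint)
    (P : seq (gint * gint)),
  (0 < Q)%N -> (Q <= 2 * nrm q0)%N -> (nrm q0 <= Q)%N -> gcoprime r0 q0 -> uniq P ->
  (forall x, x \in P -> (nrm x.1 <= Q)%N /\
     (nrm (r0 * x.1 ^+ m.+1 - x.2 * q0 ^+ m.+1)%R <= T)%N) ->
  (forall (l : gint) s, l != 0 -> (nrm l <= C * Q ^ m.+1)%N -> uniq s ->
     (forall d, d \in s -> gdvd d l) -> (size s <= D)%N) ->
  exists a, [/\ (a <= 8 * Q + 1)%N,
    (size P * Q ^ m.+1 <= a * (2 ^ m.+1 * (32 * T) + Q ^ m.+1))%N &
    (a ^ (2 ^ m) * Q ^ m.+1 <= C * Q ^ (2 ^ m) * (Q ^ m + (1 + T) * D ^ m.+1))%N].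
Proof.
have [C hC] := weyl_count m.
exists C => Q T D q0 r0 P Q0 Qq qQ co uP hP hD.
set v := q0 ^+ m.+1 in hP.
have nv : nrm v = (nrm q0 ^ m.+1)%N by rewrite nrmX.
have v0 : v != 0 by apply: gexpf_neq0; rewrite -nrm_gt0; lia.
have Qv : (Q ^ m.+1 <= 2 ^ m.+1 * nrm v)%N by rewrite nv -expnMn leq_expn2r.
pose A := undup [seq x.1 | x <- P]; exists (size A); split.
- apply: size_nrm_le; first exact: undup_uniq.
  by move=> z; rewrite mem_undup => /mapP[x /hP[h _] ->].
(* Two numerators over one denominator differ by an element whose product with [v] has norm at most
   [4 * T]; [X] bounds the norm of that element. *)
- have hX := leq_trunc_div (2 ^ m.+1 * (4 * T)) (Q ^ m.+1).
  set X := (_ %/ _)%N in hX.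
  have : (size P <= size A * (8 * X + 1))%N; last first.
    by move: (size P) (size A) (Q ^ _)%N (2 ^ _)%N hX => p a q b; clear; nia.
  apply: size_fibers => _ /mapP[x xP ->]; rewrite -size_filter.
  set s := seq.filter _ _.
  have hs y : y \in s -> y \in P /\ y.1 = x.1.
    by rewrite mem_filter => /andP[/eqP].
  rewrite -(size_map (fun y => y.2 - x.2)); apply: size_nrm_le.
    rewrite map_inj_in_uniq ?filter_uniq // => -[y1 y2] [z1 z2].
    by move=> /hs[_ /= ->] /hs[_ /= ->] /addIr ->.
  move=> _ /mapP[y /hs[yP yx] ->].
  have [_ h1] := hP y yP; have [_ h2] := hP x xP.
  have h3 := nrmB_le (r0 * x.1 ^+ m.+1 - x.2 * v) (r0 * y.1 ^+ m.+1 - y.2 * v).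
  have e3 : r0 * x.1 ^+ m.+1 - x.2 * v - (r0 * y.1 ^+ m.+1 - y.2 * v) = (y.2 - x.2) * v.
    by rewrite yx; ring.
  rewrite e3 nrmM in h3.
  rewrite leq_divRL ?expn_gt0 ?Q0 //.
  move: h1 h2 h3 Qv.
  move: (nrm _) (nrm _) (nrm _) (nrm v) (Q ^ _)%N (2 ^ _)%N.
  move=> n1 n2 n3 nw q b l1 l2 l3 l4; clear -l1 l2 l3 l4; nia.
have [u [w bez]] := gcoprime_bezoutX m.+1 co.
apply: (hC Q T D r0 u v w) => //.
- exact: undup_uniq.
- by move=> z; rewrite mem_undup => /mapP[x /hP[h _] ->].
- by rewrite nv leq_expn2r.
move=> z; rewrite mem_undup => /mapP[x /hP[_ h] ->].
by exists (r0 * x.1 ^+ m.+1 - x.2 * v), x.2; split; [ring | exact: h].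
Qed.

(** * The large sieve for points of the torus *)

Lemma ler_sum_sub (K : numDomainType) (I : eqType) (s t : seq I) (F : I -> K) :
  uniq s -> {subset s <= t} -> (forall i, 0 <= F i) ->
  \sum_(i <- s) F i <= \sum_(i <- t) F i.
Proof.
move=> us st F0; have [r hr] : exists r, perm_eq (s ++ r) t.
  elim: s us st => [|x s IH] /= ; first by exists t.
  case/andP => xs us st; have [|r hr] := IH us.
    by move=> y ys; apply: st; rewrite inE ys orbT.
  have xr : x \in r.
    have : x \in t by apply: st; rewrite mem_head.
    by rewrite -(perm_mem hr) mem_cat (negPf xs).
  exists (rem x r); apply: perm_trans (_ : perm_eq (s ++ x :: rem x r) _).
    by rewrite -[x :: s ++ _]cat1s -[x :: rem x r]cat1s perm_catCA.
  by apply: perm_trans hr; rewrite perm_cat2l perm_sym perm_to_rem.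
by rewrite -(perm_big _ hr) big_cat /= lerDl sumr_ge0.
Qed.

(** * Duality and Schur's test *)

Section NumClosed.
Variable C : numClosedFieldType.
Implicit Types x y z : C.

Lemma norm_sqr x : `|x| ^+ 2 = x * x^*.
Proof. exact: normCK. Qed.

Lemma mul2_norm_le (x y : C) : 2 * (`|x| * `|y|) <= `|x| ^+ 2 + `|y| ^+ 2.
Proof.
rewrite mulr_natl; have := real_leif_mean_square_scaled (normr_real x) (normr_real y).
by case.
Qed.

(** With [b] the conjugate of [S], the hypothesis bounds the sum of [|z i|^2] by [B X], while [X] is
    the sum of the [a i * z i]. The inequality [2 B |a z| <= B^2 |a|^2 + |z|^2] replaces Cauchy's
    and avoids dividing by [X]. *)
Lemma duality (I J : Type) (s : seq I) (t : seq J) (f : I -> J -> C) (B : C) :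
  0 < B ->
  (forall b : J -> C, \sum_(i <- s) `|\sum_(j <- t) b j * f i j| ^+ 2
     <= B * \sum_(j <- t) `|b j| ^+ 2) ->
  forall a : I -> C, \sum_(j <- t) `|\sum_(i <- s) a i * f i j| ^+ 2
     <= B * \sum_(i <- s) `|a i| ^+ 2.
Proof.
move=> B0 h a; set S := fun j => \sum_(i <- s) a i * f i j.
pose z i := \sum_(j <- t) (S j)^* * f i j.
set X := \sum_(j <- t) _; set A := \sum_(i <- s) `|a i| ^+ 2.
have hz : \sum_(i <- s) `|z i| ^+ 2 <= B * X.
  apply: le_trans (h (fun j => (S j)^*)) _; rewrite ler_pM2l //.
  by apply: ler_sum => j _; rewrite norm_conjC.
have XE : X = \sum_(i <- s) a i * z i.
  rewrite /X; under eq_bigr do rewrite norm_sqr /S mulr_suml.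
  rewrite exchange_big /=; apply: eq_bigr => i _; rewrite /z mulr_sumr.
  by apply: eq_bigr => j _; rewrite /S mulrAC mulrA.
have X0 : 0 <= X by apply: sumr_ge0 => j _; exact: exprn_ge0.
have h2 : 2 * B * X <= B ^+ 2 * A + B * X.
  apply: le_trans (_ : B ^+ 2 * A + \sum_(i <- s) `|z i| ^+ 2 <= _); last first.
    by rewrite lerD2l.
  rewrite -(ger0_norm X0) XE.
  apply: le_trans (ler_wpM2l _ (ler_norm_sum _ _ _)) _.
    by rewrite mulr_ge0 ?ler0n // ltW.
  rewrite /A !mulr_sumr -big_split /=; apply: ler_sum => i _.
  rewrite -{2}(ger0_norm (ltW B0)) -exprMn -normrM normrM.
  have := mul2_norm_le (B * a i) (z i); rewrite !normrM (ger0_norm (ltW B0)).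
  by rewrite -!mulrA.
rewrite -(ler_pM2l B0) -(lerD2r (B * X)) [B * (B * A)]mulrA -expr2.
by have -> : B * X + B * X = 2 * B * X by ring.
Qed.

(** From [2 |b i| |b j| <= |b i|^2 + |b j|^2]; the two halves agree by the symmetry of [|M|]. *)
Lemma schur_bound (J : eqType) (t : seq J) (M : J -> J -> C) (L : C) :
  (forall i j, `|M i j| = `|M j i|) ->
  (forall i, i \in t -> \sum_(j <- t) `|M i j| <= L) ->
  forall b : J -> C, `|\sum_(i <- t) \sum_(j <- t) b i * (b j)^* * M i j|
    <= L * \sum_(i <- t) `|b i| ^+ 2.
Proof.
move=> sM hM b.
apply: le_trans (ler_norm_sum _ _ _) _.
have h1 : \sum_(i <- t) \sum_(j <- t) `|b i| ^+ 2 * `|M i j|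
   <= L * \sum_(i <- t) `|b i| ^+ 2.
  rewrite mulr_sumr big_seq [X in _ <= X]big_seq; apply: ler_sum => i it.
  by rewrite -mulr_sumr mulrC ler_wpM2r ?hM // exprn_ge0.
rewrite -(ler_pM2l (ltr0Sn C 1)); apply: le_trans (_ : _ <= \sum_(i <- t)
   \sum_(j <- t) `|b i| ^+ 2 * `|M i j| + \sum_(i <- t)
   \sum_(j <- t) `|b i| ^+ 2 * `|M i j|) _; last first.
  by rewrite mulr_natl mulr2n lerD.
rewrite [X in _ <= _ + X]exchange_big /= -big_split mulr_sumr /=.
apply: ler_sum => i _; rewrite -big_split /=.
apply: le_trans (ler_wpM2l _ (ler_norm_sum _ _ _)) _; first exact: ler0n.
rewrite mulr_sumr; apply: ler_sum => j _.
rewrite sM (_ : `|M j i| = `|M i j|) // -mulrDl !normrM norm_conjC mulrA.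
by rewrite ler_wpM2r // mul2_norm_le.
Qed.

(** Every [n] in the small square is [u - u'] for each [u'] of that square, with [u = n + u'] in the
    doubled one. The right side is the convolution that produces squared kernels. *)
Lemma smoothing (s : nat) (F : gint -> C) : (forall n, 0 <= F n) ->
  ((2 * s).+1 ^ 2)%:R * \sum_(n <- gboxl s) F n <=
  \sum_(u' <- gboxl (2 * s)) \sum_(u <- gboxl (2 * s)) F (u - u').
Proof.
move=> F0; pose G u' := \sum_(u <- gboxl (2 * s)) F (u - u').
apply: le_trans (_ : _ <= \sum_(u' <- gboxl s) G u') _; last first.
  apply: ler_sum_sub; first exact: uniq_gboxl.
    by move=> z; rewrite !gboxlP; lia.
  by move=> u'; apply: sumr_ge0.
rewrite -size_gboxl mulr_natl -[_ *+ _]addr0 -iter_addr -(count_predT (gboxl s)).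
rewrite -big_const_seq big_seq [X in _ <= X]big_seq.
apply: ler_sum => u' hu'; rewrite /G.
have -> : \sum_(n <- gboxl s) F n =
    \sum_(u <- [seq n + u' | n <- gboxl s]) F (u - u').
  by rewrite big_map; apply: eq_bigr => n _; rewrite addrK.
apply: ler_sum_sub => //; first by rewrite map_inj_uniq ?uniq_gboxl //; exact: addIr.
move=> _ /mapP[n hn ->]; move: hn hu'; case: n u' => a b [c d].
by rewrite gintD !gboxlP /= => /andP[? ?] /andP[? ?]; lia.
Qed.

(** After smoothing, the quadratic form has coefficients [|G i j|^2], with [G] a character sum over
    a square. Their decay makes the row sums in Schur's test bounded, whereas [G] itself would lose
    logarithms. *)
Lemma dual_large_sieve (J : eqType) (t : seq J) (chi : gint -> J -> C) s (L : C) :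
  (forall n n' j, chi (n - n') j = chi n j * (chi n' j)^*) ->
  (forall i, i \in t -> \sum_(j <- t)
     `|\sum_(u <- gboxl (2 * s)) chi u i * (chi u j)^*| ^+ 2 <= L) ->
  forall b : J -> C,
  ((2 * s).+1 ^ 2)%:R * \sum_(n <- gboxl s) `|\sum_(j <- t) b j * chi n j| ^+ 2
    <= L * \sum_(j <- t) `|b j| ^+ 2.
Proof.
move=> chiB hL b.
apply: le_trans (smoothing _ _) _; first by move=> n; exact: exprn_ge0.
set U := gboxl (2 * s); pose G i j := \sum_(u <- U) chi u i * (chi u j)^*.
have E : \sum_(u' <- U) \sum_(u <- U) `|\sum_(j <- t) b j * chi (u - u') j| ^+ 2 =
   \sum_(i <- t) \sum_(j <- t) b i * (b j)^* * `|G i j| ^+ 2.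
  transitivity (\sum_(u' <- U) \sum_(u <- U) \sum_(i <- t) \sum_(j <- t)
     b i * (b j)^* * ((chi u i * (chi u j)^*) * (chi u' i * (chi u' j)^*)^*)).
    apply: eq_bigr => u' _; apply: eq_bigr => u _.
    rewrite norm_sqr rmorph_sum mulr_suml; apply: eq_bigr => i _.
    rewrite mulr_sumr; apply: eq_bigr => j _.
    by rewrite !chiB !rmorphM /= !conjCK; ring.
  under eq_bigr do rewrite exchange_big /=.
  rewrite exchange_big /=; apply: eq_bigr => i _.
  under eq_bigr do rewrite exchange_big /=.
  rewrite exchange_big /=; apply: eq_bigr => j _.
  rewrite norm_sqr /G rmorph_sum mulr_sumr mulr_sumr; apply: eq_bigr => u' _.
  by rewrite mulrA mulr_sumr mulr_suml; apply: eq_bigr => u _; ring.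
rewrite E -[X in X <= _]ger0_norm; last first.
  rewrite -E; apply: sumr_ge0 => u' _; apply: sumr_ge0 => u _; exact: exprn_ge0.
apply: schur_bound => [i j|i it].
  rewrite !normrX !normr_id; congr (_ ^+ 2); rewrite -norm_conjC /G rmorph_sum.
  by congr (`|_|); apply: eq_bigr => u _; rewrite rmorphM /= conjCK mulrC.
by under eq_bigr do rewrite normrX normr_id; exact: hL.
Qed.

End NumClosed.

(** * The squared Dirichlet kernel *)

Section Kernel.
Variable R : realType.
Local Notation C := R[i].

Definition nsq (z : C) : R := complex.Re z ^+ 2 + complex.Im z ^+ 2.

Lemma nsqM (z w : C) : nsq (z * w) = nsq z * nsq w.
Proof. by case: z w => a b [c d]; rewrite /nsq /=; ring. Qed.

Lemma nsq_ge0 (z : C) : 0 <= nsq z.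
Proof. by rewrite addr_ge0 ?sqr_ge0. Qed.

Lemma cabs_sqr (z : C) : cabs z ^+ 2 = nsq z.
Proof. by case: z => a b; rewrite /cabs /= sqr_sqrtr // addr_ge0 ?sqr_ge0. Qed.

Lemma normC_sqr (z : C) : `|z| ^+ 2 = (nsq z)%:C%C.
Proof. by rewrite normc_def -rmorphXn /= sqr_sqrtr // addr_ge0 ?sqr_ge0. Qed.

Lemma e0 : e (0 : R) = 1.
Proof. by rewrite /e mulr0 cos0 sin0. Qed.

Lemma eD (x y : R) : e (x + y) = e x * e y.
Proof.
by rewrite /e mulrDr cosD sinD; congr Complex => /=; ring.
Qed.

Lemma eN (x : R) : e (- x) = (e x)^*.
Proof. by rewrite /e mulrN cosN sinN. Qed.

Lemma e1 : e (1 : R) = 1.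
Proof.
rewrite /e mulr1; have -> : 2 * pi = pi *+ 2 :> R by rewrite mulr_natl.
by rewrite cos2pi sin2pi.
Qed.

Lemma e_nat (x : R) n : e (x *+ n) = e x ^+ n.
Proof. by elim: n => [|n IH]; rewrite ?mulr0n ?e0 // mulrS eD IH exprS. Qed.

Lemma e_int (m : int) : e (m%:~R : R) = 1.
Proof.
case: m => n.
  by rewrite -[RHS](expr1n _ n) -e1 -e_nat.
by rewrite NegzE mulrNz eN -pmulrn e_nat e1 expr1n conjC1.
Qed.

Lemma nsq_e (x : R) : nsq (e x) = 1.
Proof. by rewrite /nsq /= cos2Dsin2. Qed.

Lemma norm_e (x : R) : `|e x| = 1 :> C.
Proof. by rewrite normc_def -/(nsq _) nsq_e sqrtr1. Qed.

Definition dker (L : nat) (x : R) : C := \sum_(0 <= i < L) e (x *+ i).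

Definition kernel (L : nat) (x : R) : R := nsq (dker L x).

Lemma kernel_le (L : nat) (x : R) : kernel L x <= L%:R ^+ 2.
Proof.
rewrite -lecR /kernel -normC_sqr rmorphXn /= ler_sqr ?nnegrE ?normr_ge0 //; last first.
  by rewrite lecR ler0n.
apply: le_trans (ler_norm_sum _ _ _) _.
under eq_bigr do rewrite norm_e.
by rewrite sumr_const_nat subn0 rmorph_nat.
Qed.

Lemma dker_geom (L : nat) (x : R) : (e x - 1) * dker L x = e (x *+ L) - 1.
Proof.
rewrite /dker; elim: L => [|L IH]; first by rewrite big_nil mulr0 mulr0n e0 subrr.
by rewrite big_nat_recr //= mulrDr IH mulrS eD; ring.
Qed.

Lemma nsq_e_sub1 (x : R) : nsq (e x - 1) = 4 * sin (pi * x) ^+ 2.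
Proof.
have -> : e x - 1 = Complex (cos (2 * pi * x) - 1) (sin (2 * pi * x)).
  by rewrite /e; congr Complex => /=; rewrite oppr0 addr0.
rewrite /nsq /=; have -> : 2 * pi * x = (pi * x) *+ 2 by ring.
rewrite cos_mulr2n sin_mulr2n; have := cos2Dsin2 (pi * x).
set c := cos _; set s := sin _ => h.
have -> : s ^+ 2 = 1 - c ^+ 2 by rewrite -h; ring.
have -> : (c * s *+ 2) ^+ 2 = 4 * c ^+ 2 * s ^+ 2 by ring.
have -> : s ^+ 2 = 1 - c ^+ 2 by rewrite -h; ring.
ring.
Qed.

Lemma kernel_sin (L : nat) (x : R) : sin (pi * x) ^+ 2 * kernel L x <= 1.
Proof.
rewrite -(ler_pM2l (_ : 0 < 4 :> R)) // mulrA -nsq_e_sub1 -nsqM dker_geom mulr1.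
by rewrite nsq_e_sub1 -[leRHS]mulr1 ler_pM2l //.
Qed.

(** With [a = pi y / 2], [sin (2 a) = 2 sin a cos a], and [sin a = a cos c] by the mean value
    theorem; both cosines are at least [1 / 2] on [[0, pi / 4]]. *)
Lemma sin_lower (y : R) : 0 <= y -> y <= 1 / 2 -> y / 2 <= sin (pi * y).
Proof.
move=> y0 y1; have pi2 := pi_ge2 R; have pi0 := pi_gt0 R.
set a := pi * y / 2.
have a0 : 0 <= a by rewrite /a; nra.
have a1 : a <= pi / 4 by rewrite /a; nra.
have -> : pi * y = a *+ 2 by rewrite /a; field.
have cos_half (c : R) : 0 <= c -> c <= pi / 4 -> 1 / 2 <= cos c.
  move=> c0 c1; have c2 : 0 <= cos c by apply: cos_ge0_pihalf; lra.
  have : 0 <= cos (c *+ 2) by apply: cos_ge0_pihalf; rewrite -mulr_natl; lra.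
  rewrite cos_mulr2n => h; nra.
have [c hc hs] : exists2 c, c \in `[0, a] & sin a - sin 0 = cos c * (a - 0).
  apply: (@MVT_segment R (@sin R) (@cos R)) => //.
  exact/continuous_subspaceT/continuous_sin.
move: hc hs; rewrite in_itv /= => /andP[c0 c1]; rewrite sin0 !subr0 => hs.
have h1 := cos_half c c0 (le_trans c1 a1).
have h2 := cos_half a a0 a1.
have ya : y <= a by rewrite /a; clear -y0 pi2; nra.
have h3 : 1 / 4 <= cos a * cos c by clear -h1 h2; nra.
by rewrite sin_mulr2n hs mulrA; clear -h3 a0 ya; nra.
Qed.
End Kernel.

(** * Division of the circle into cells *)

Section Cells.
Variable R : realType.

Lemma kernel_int (L : nat) (x : R) (m : int) : kernel L (x + m%:~R) = kernel L x.
Proof.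
rewrite /kernel /dker; congr nsq; apply: eq_bigr => i _.
by rewrite mulrnDl eD [e (_%:~R *+ _)]e_nat e_int expr1n mulr1.
Qed.

Definition fracp (x : R) : R := x - (Num.floor x)%:~R.

Lemma fracp_itv (x : R) : 0 <= fracp x < 1.
Proof.
have := floor_itv x; rewrite /fracp intrD => /andP[h1 h2].
apply/andP; split; lra.
Qed.

Lemma kernel_fracp (L : nat) (x : R) : kernel L (fracp x) = kernel L x.
Proof. by rewrite /fracp -mulrNz kernel_int. Qed.

Definition cell (L : nat) (x : R) : nat := Num.trunc (L%:R * fracp x).

Lemma cell_itv (L : nat) (x : R) :
  (cell L x)%:R <= L%:R * fracp x < (cell L x)%:R + 1.
Proof.
rewrite natr1; apply: truncn_itv; rewrite mulr_ge0 ?ler0n //.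
by case/andP: (fracp_itv x).
Qed.

Lemma cell_lt (L : nat) (x : R) : (0 < L)%N -> (cell L x < L)%N.
Proof.
move=> L0; rewrite -(ltr_nat R); have /andP[h _] := cell_itv L x.
apply: le_lt_trans h _; have /andP[_ h] := fracp_itv x.
have : 0 < L%:R :> R by rewrite ltr0n.
by move=> h0; rewrite -[ltRHS]mulr1 ltr_pM2l.
Qed.

Lemma cell_close (L : nat) (x y : R) : (0 < L)%N -> cell L x = cell L y ->
  exists m : int, `|x - y - m%:~R| * L%:R < 1.
Proof.
move=> L0 E; exists (Num.floor x - Num.floor y).
have -> : x - y - (Num.floor x - Num.floor y)%:~R = fracp x - fracp y.
  by rewrite /fracp rmorphB /=; ring.
have /andP[h1 h2] := cell_itv L x; have /andP[h3 h4] := cell_itv L y.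
rewrite -E in h3 h4.
rewrite -[L%:R]ger0_norm ?ler0n // -normrM ltr_norml mulrBl mulrC [fracp y * _]mulrC.
by apply/andP; split; lra.
Qed.

(** A bound for [kernel L / L^2] on cell [c]; the terms measure the distance to the two ends of the
    unit interval. The [16] is the [4] of [kernel_itv] times the [4] lost in replacing [c] by
    [(c + 1) / 2]. *)
Definition cell_weight (L c : nat) : R :=
  16 * ((c.+1%:R ^+ 2)^-1 + ((L - c)%:R ^+ 2)^-1).

Lemma cell_weight_ge0 L c : 0 <= cell_weight L c.
Proof. by rewrite mulr_ge0 // addr_ge0 // invr_ge0 sqr_ge0. Qed.

Lemma sqr_inv_le (x y : R) : 0 < y -> y <= x -> (x ^+ 2)^-1 <= (y ^+ 2)^-1.
Proof.
move=> y0 yx; have x0 := lt_le_trans y0 yx.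
by rewrite lef_pV2 ?posrE ?exprn_gt0 // ler_sqr // nnegrE ltW.
Qed.

Lemma kernel_itv (L : nat) (y : R) : 0 < y -> y < 1 ->
  kernel L y <= 4 * ((y ^+ 2)^-1 + ((1 - y) ^+ 2)^-1).
Proof.
move=> y0 y1; have hs := kernel_sin L y; have k0 := nsq_ge0 (dker L y).
rewrite -/(kernel L y) in k0.
have key z : 0 < z -> z <= 1 / 2 -> sin (pi * z) ^+ 2 = sin (pi * y) ^+ 2 ->
    kernel L y <= 4 * (z ^+ 2)^-1.
  move=> z0 z1 E; rewrite -E in hs; have h := sin_lower (ltW z0) z1.
  rewrite -(ler_pM2r (_ : 0 < z ^+ 2)) ?exprn_gt0 // -mulrA mulVf ?mulr1; last first.
    by rewrite expf_neq0 // gt_eqF.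
  have : (z / 2) ^+ 2 <= sin (pi * z) ^+ 2.
    by rewrite ler_sqr // nnegrE; lra.
  rewrite expr_div_n => h2; have := ler_wpM2r k0 h2 => h3.
  lra.
have i1 : 0 <= (y ^+ 2)^-1 by rewrite invr_ge0 sqr_ge0.
have i2 : 0 <= ((1 - y) ^+ 2)^-1 by rewrite invr_ge0 sqr_ge0.
have [h|h] := leP y (1 / 2).
  have := key y y0 h erefl; lra.
have := key (1 - y); rewrite subr_gt0 => /(_ y1).
have E : sin (pi * (1 - y)) ^+ 2 = sin (pi * y) ^+ 2.
  have -> : pi * (1 - y) = - (pi * y) + pi by ring.
  by rewrite sinDpi sinN opprK.
move/(_ _ E); lra.
Qed.

Lemma kernel_cell (L : nat) (x : R) : (0 < L)%N ->
  kernel L x <= L%:R ^+ 2 * cell_weight L (cell L x).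
Proof.
move=> L0; have cL := cell_lt x L0; have /andP[h1 h2] := cell_itv L x.
move: cL h1 h2; rewrite -kernel_fracp; move: (cell L x) (fracp x) (fracp_itv x).
move=> c y /andP[y0 y1] cL h1 h2.
have LR : 0 < L%:R :> R by rewrite ltr0n.
(* In the first and the last cell one term of the weight is [16], and the trivial bound [L ^ 2]
   suffices. *)
have tr : 1 <= cell_weight L c -> kernel L y <= L%:R ^+ 2 * cell_weight L c.
  move=> h; apply: le_trans (kernel_le L y) _.
  by rewrite -[leLHS]mulr1 ler_pM2l // exprn_gt0.
have i1 : 0 <= (c.+1%:R ^+ 2)^-1 :> R by rewrite invr_ge0 sqr_ge0.
have i2 : 0 <= ((L - c)%:R ^+ 2)^-1 :> R by rewrite invr_ge0 sqr_ge0.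
have [c0|c0] := posnP c.
  apply: tr; rewrite /cell_weight {i1}; subst c; move: i2; rewrite expr1n invr1.
  by move: (_^-1) => w; lra.
have [cL1|cL1] := leqP (L - c) 1.
  have E : (L - c = 1)%N by lia.
  by apply: tr; rewrite /cell_weight E expr1n invr1; move: (_ ^+ 2)^-1 i1 => w; lra.
have E : (L - c)%:R = L%:R - c%:R :> R by rewrite natrB // ltnW.
have c1 : 1 <= c%:R :> R by rewrite ler1n.
have c2 : c%:R <= L%:R - 2 :> R.
  move: (cL1 : (2 <= L - c)%N); rewrite -(ler_nat R) E; lra.
have y0' : 0 < y by rewrite -(pmulr_rgt0 _ LR); lra.
apply: le_trans (kernel_itv L y0' y1) _; rewrite /cell_weight.
(* Here [1 <= c <= L - 2], so [c >= (c + 1) / 2] and [L - c - 1 >= (L - c) / 2]. *)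
have a1 : (y ^+ 2)^-1 <= L%:R ^+ 2 * 4 * (c.+1%:R ^+ 2)^-1.
  apply: le_trans (@sqr_inv_le _ (c.+1%:R / (2 * L%:R)) _ _) _.
  - by rewrite divr_gt0 // mulr_gt0.
  - by rewrite ler_pdivrMr ?mulr_gt0 // -natr1; lra.
  - by rewrite expr_div_n invf_div exprMn; rewrite le_eqVlt; apply/orP; left; apply/eqP; ring.
have a2 : ((1 - y) ^+ 2)^-1 <= L%:R ^+ 2 * 4 * ((L - c)%:R ^+ 2)^-1.
  apply: le_trans (@sqr_inv_le _ ((L - c)%:R / (2 * L%:R)) _ _) _.
  - by rewrite divr_gt0 ?mulr_gt0 // ltr0n; lia.
  - by rewrite ler_pdivrMr ?mulr_gt0 // E; lra.
  - by rewrite expr_div_n invf_div exprMn; rewrite le_eqVlt; apply/orP; left; apply/eqP; ring.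
move: a1 a2; move: ((y ^+ 2)^-1) (((1 - y) ^+ 2)^-1) => u1 u2.
move: ((c.+1%:R ^+ 2)^-1) (((L - c)%:R ^+ 2)^-1) (L%:R ^+ 2) => w1 w2 l; lra.
Qed.

Lemma sum_inv_sqr (L : nat) : \sum_(0 <= c < L) (c.+1%:R ^+ 2)^-1 <= 2 :> R.
Proof.
case: L => [|L]; first by rewrite big_nil.
(* Strengthened so that the induction telescopes. *)
suff : \sum_(0 <= c < L.+1) (c.+1%:R ^+ 2)^-1 <= 2 - (L.+1%:R)^-1 :> R.
  by move/le_trans; apply; rewrite gerBl invr_ge0.
elim: L => [|L IH]; first by rewrite big_nat1 expr1n invr1; lra.
rewrite big_nat_recr //=; apply: le_trans (lerD IH (lexx _)) _.
have x0 : 0 < L.+1%:R :> R by rewrite ltr0n.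
have -> : L.+2%:R = L.+1%:R + 1 :> R by rewrite natr1.
move: (L.+1%:R) x0 => x x0; rewrite -subr_ge0.
have -> : 2 - (x + 1)^-1 - (2 - x^-1 + ((x + 1) ^+ 2)^-1) =
   (x * (x + 1) ^+ 2)^-1.
  by field; apply/andP; split; lra.
by rewrite invr_ge0 mulr_ge0 ?sqr_ge0 // ltW.
Qed.

Lemma sum_cell_weight (L : nat) : \sum_(0 <= c < L) cell_weight L c <= 64.
Proof.
rewrite /cell_weight -mulr_sumr big_split /=.
have -> : \sum_(0 <= c < L) ((L - c)%:R ^+ 2)^-1 =
    \sum_(0 <= c < L) (c.+1%:R ^+ 2)^-1 :> R.
  rewrite big_nat_rev /= add0n; rewrite [LHS]big_nat [RHS]big_nat; apply: eq_bigr.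
  by move=> c /andP[_ h]; congr ((_%:R ^+ 2)^-1); lia.
have := sum_inv_sqr L; move: (\sum_(_ <= _ < _) _) => S; lra.
Qed.
End Cells.

Lemma ler_sum_count (K : numDomainType) (I J : eqType) (t : seq I) (S : seq J)
    (g : I -> J) (F : J -> K) (k : nat) :
  uniq S -> (forall i, i \in t -> g i \in S) -> (forall c, 0 <= F c) ->
  (forall c, (count (fun i => g i == c) t <= k)%N) ->
  \sum_(i <- t) F (g i) <= k%:R * \sum_(c <- S) F c.
Proof.
move=> uS gS F0 hk.
have -> : \sum_(i <- t) F (g i) = \sum_(c <- S) (count (fun i => g i == c) t)%:R * F c.
  transitivity (\sum_(i <- t) \sum_(c <- S) (g i == c)%:R * F c).
    rewrite big_seq [RHS]big_seq; apply: eq_bigr => i it.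
    rewrite (bigD1_seq (g i)) ?gS //= eqxx mul1r big1 ?addr0 // => c.
    by rewrite eq_sym => /negPf->; rewrite mul0r.
  rewrite exchange_big /=; apply: eq_bigr => c _.
  rewrite -mulr_suml -sum1_count natr_sum [X in _ = X * _]big_mkcond /=.
  by congr (_ * _); apply: eq_bigr => i _; case: eqP.
rewrite mulr_sumr; apply: ler_sum => c _.
by rewrite ler_wpM2r // ler_nat.
Qed.

(** * The large sieve inequality *)

Section LargeSieve.
Variable R : realType.

Definition chi (n : gint) (x : R * R) : R[i] :=
  e ((complex.Re n)%:~R * x.1 + (complex.Im n)%:~R * x.2).

Lemma chiB n n' x : chi (n - n') x = chi n x * (chi n' x)^*.
Proof.
case: n n' => a b [c d]; rewrite gintN gintD /chi -eN -eD /= !intrD !intrN.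
by congr e; ring.
Qed.

Lemma norm_gram (s : nat) (x y : R * R) :
  `|\sum_(u <- gboxl (2 * s)) chi u x * (chi u y)^*| ^+ 2 =
  (kernel (4 * s).+1 (x.1 - y.1) * kernel (4 * s).+1 (x.2 - y.2))%:C%C.
Proof.
set d1 := x.1 - y.1; set d2 := x.2 - y.2; rewrite rmorphM /= -!normC_sqr -!exprMn.
rewrite -normrM; congr (_ ^+ 2).
(* The sums over the square are centred while [dker] starts at 0; a factor of modulus 1 accounts for
   the shift by [2 * s]. *)
rewrite -[RHS]mul1r -(norm_e (- ((2 * s)%:R * (d1 + d2)))) -normrM; congr (`|_|).
rewrite /gboxl (_ : (2 * (2 * s)).+1 = (4 * s).+1); last by lia.
rewrite big_allpairs_dep /dker mulr_suml mulr_sumr /index_iota subn0.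
apply: eq_bigr => i _; rewrite !mulr_sumr; apply: eq_bigr => j _.
rewrite /chi -eN -!eD /=; congr e.
by rewrite !intrB -!pmulrn -[d1 *+ i]mulr_natl -[d2 *+ j]mulr_natl /d1 /d2; ring.
Qed.

Definition closeb (L : nat) (x y : R * R) : bool :=
  `[< exists z : gint, `|x.1 - y.1 - (complex.Re z)%:~R| * L%:R < 1 /\
                       `|x.2 - y.2 - (complex.Im z)%:~R| * L%:R < 1 >].

(** The points are sorted by the cells of the two coordinates of [p - x j]. Points sharing a pair of
    cells are close to one another, so each pair holds at most [k] of them, and the weights of all
    cells sum to at most 64 per coordinate. *)
Lemma sum_kernel (J : eqType) (t : seq J) (x : J -> R * R) (p : R * R) (L k : nat) :
  (0 < L)%N ->
  (forall i, i \in t -> (count (fun j => closeb L (x i) (x j)) t <= k)%N) ->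
  \sum_(j <- t) kernel L (p.1 - (x j).1) * kernel L (p.2 - (x j).2)
    <= k%:R * (L%:R ^+ 4 * 64 ^+ 2).
Proof.
move=> L0 hk.
pose g j := (cell L (p.1 - (x j).1), cell L (p.2 - (x j).2)).
pose F (c : nat * nat) : R := L%:R ^+ 4 * (cell_weight R L c.1 * cell_weight R L c.2).
pose S := [seq (a, b) | a <- index_iota 0 L, b <- index_iota 0 L].
apply: le_trans (_ : _ <= \sum_(j <- t) F (g j)) _.
  apply: ler_sum => j _; rewrite /F /=.
  have -> : L%:R ^+ 4 = L%:R ^+ 2 * L%:R ^+ 2 :> R by rewrite -exprD.
  by rewrite mulrACA ler_pM ?nsq_ge0 ?kernel_cell.
apply: le_trans (@ler_sum_count R J _ t S g F k _ _ _ _) _.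
- by apply: allpairs_uniq; rewrite ?iota_uniq // => -[? ?] [? ?].
- move=> j _; apply/allpairsP; exists (g j).
  by rewrite !mem_index_iota /= !cell_lt.
- by move=> c; rewrite /F !mulr_ge0 ?cell_weight_ge0 ?exprn_ge0.
- move=> c; have [/hasP[j0 j0t /eqP gj0]|] := boolP (has (fun j => g j == c) t); last first.
    by rewrite has_count -eqn0Ngt => /eqP->.
  apply: leq_trans (hk j0 j0t); apply: sub_count => j /eqP gj.
  have [c1 c2] : cell L (p.1 - (x j).1) = cell L (p.1 - (x j0).1) /\
      cell L (p.2 - (x j).2) = cell L (p.2 - (x j0).2).
    by move: gj; rewrite -gj0 => -[].
  have [m1 h1] := cell_close L0 c1; have [m2 h2] := cell_close L0 c2.
  apply/asboolP; exists (Complex m1 m2) => /=.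
  have dE (a b q : R) : q - a - (q - b) = b - a by ring.
  by rewrite !dE in h1 h2.
rewrite /F -mulr_sumr ler_wpM2l // ler_wpM2l ?exprn_ge0 //.
rewrite big_allpairs_dep /=; under eq_bigr do rewrite -mulr_sumr.
rewrite -mulr_suml expr2.
by apply: ler_pM; rewrite ?sum_cell_weight // sumr_ge0 // => c _; exact: cell_weight_ge0.
Qed.

Lemma large_sieve : exists c : R, 0 < c /\
  forall (J : eqType) (t : seq J) (x : J -> R * R) (s k : nat), (0 < k)%N ->
  (forall i, i \in t -> (count (fun j => closeb (4 * s).+1 (x i) (x j)) t <= k)%N) ->
  forall a : gint -> R[i],
  \sum_(j <- t) cabs (\sum_(n <- gboxl s) a n * chi n (x j)) ^+ 2
    <= c * k%:R * (4 * s).+1%:R ^+ 2 * \sum_(n <- gboxl s) cabs (a n) ^+ 2.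
Proof.
(* This is [4 * 64 ^ 2], the [4] coming from [L <= 2 * (2 * s).+1]. *)
exists 16384; split; first by rewrite ltr0n.
move=> J t x s k k0 hk a; set L := (4 * s).+1 in hk *.
under eq_bigr do rewrite cabs_sqr; under [X in _ <= _ * X]eq_bigr do rewrite cabs_sqr.
have B0 : 0 < 16384 * k%:R * L%:R ^+ 2 :> R.
  by rewrite !mulr_gt0 ?exprn_gt0 ?ltr0n.
rewrite -lecR rmorphM /= !rmorph_sum /=.
under eq_bigr do rewrite -normC_sqr; under [X in _ <= _ * X]eq_bigr do rewrite -normC_sqr.
apply: (@duality _ _ _ (gboxl s) t (fun n j => chi n (x j))); first by rewrite ltcR.
move=> b; have LC : 0 < ((2 * s).+1 ^ 2)%:R :> R[i] by rewrite ltr0n expn_gt0.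
rewrite -(ler_pM2l LC).
apply: le_trans (@dual_large_sieve _ _ t (fun n j => chi n (x j)) s
   (k%:R * (L%:R ^+ 4 * 64 ^+ 2))%:C%C _ _ b) _.
- by move=> n n' j; exact: chiB.
- move=> i it; under eq_bigr do rewrite norm_gram.
  by rewrite -rmorph_sum lecR; exact: sum_kernel.
rewrite [X in _ <= X]mulrA ler_wpM2r //; first by apply: sumr_ge0 => j _; exact: exprn_ge0.
rewrite -[((2 * s).+1 ^ 2)%:R](rmorph_nat (real_complex R)) -rmorphM /= lecR.
have -> : k%:R * (L%:R ^+ 4 * 64 ^+ 2) = 4096 * k%:R * L%:R ^+ 2 * (L ^ 2)%:R :> R.
  by rewrite natrX; ring.
have -> : ((2 * s).+1 ^ 2)%:R * (16384 * k%:R * L%:R ^+ 2) =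
   4096 * k%:R * L%:R ^+ 2 * (4 * (2 * s).+1 ^ 2)%:R :> R by rewrite natrM; ring.
apply: ler_wpM2l.
  apply: mulr_ge0; last exact: exprn_ge0.
  by apply: mulr_ge0; exact: ler0n.
by rewrite ler_nat /L -(expnMn 2 _ 2) leq_sqr; clear; lia.
Qed.
End LargeSieve.

(** * Farey fractions with k-th power denominators *)

Section Reals.
Variable R : realType.

(** [D] is the largest integer with [D ^ t <= C2 * Q ^ k]; as [t >= k ^ 2 / eps], its [k]-th power
    is [O(Q^eps)]. The [k]-th power is what the count of words of [k] divisors requires. *)
Lemma divisor_count (k : nat) (eps : R) (C0 : nat) : 0 < eps ->
  exists C : R, 1 <= C /\ forall Q : nat, (0 < Q)%N -> exists D : nat,
    [/\ (0 < D)%N, D%:R ^+ k <= C * Q%:R `^ eps &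
    forall (l : gint) s, l != 0 -> (nrm l <= C0 * Q ^ k)%N -> uniq s ->
     (forall d, d \in s -> gdvd d l) -> (size s <= D)%N].
Proof.
move=> eps0.
pose t := (Num.trunc ((k ^ 2)%:R / eps)).+1.
have ht : (k ^ 2)%:R <= eps * t%:R.
  have : 0 <= (k ^ 2)%:R / eps :> R by rewrite divr_ge0 ?ler0n ?ltW.
  move=> /truncn_itv /andP[_]; rewrite ltr_pdivrMr // mulrC => /ltW //.
have [C1 hC1] := divisor_bound t.
pose C2 := (C1 * C0 + 1)%N.
exists (C2%:R ^+ k); split; first by rewrite exprn_ege1 // ler1n /C2 addn1.
move=> Q Q0.
have P0 : exists n, (n ^ t <= C2 * Q ^ k)%N by exists 0%N; rewrite exp0n.
have Pb n : (n ^ t <= C2 * Q ^ k)%N -> (n <= C2 * Q ^ k)%N.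
  apply: leq_trans; case: n => // n; rewrite -{1}[n.+1]expn1; exact: leq_pexp2l.
case: (ex_maxnP P0 Pb) => D hD Dmax; exists D.
split.
- by apply: Dmax; rewrite exp1n muln_gt0 expn_gt0 Q0 /C2 addn1.
- rewrite -(@ler_pXn2r _ t) ?nnegrE ?exprn_ge0 ?mulr_ge0 ?exprn_ge0 ?powR_ge0 //.
  rewrite exprMn exprAC; apply: le_trans (_ : _ <= (C2 * Q ^ k)%:R ^+ k) _.
    by apply: lerXn2r; rewrite ?nnegrE ?exprn_ge0 // -natrX ler_nat.
  rewrite natrM exprMn; apply: ler_pM; rewrite ?exprn_ge0 //.
    by rewrite -exprM ler_weXn2l ?ler1n /C2 ?addn1 // leq_pmulr.
  rewrite natrX -exprM mulnn -powR_mulrn // -powR_mulrn ?powR_ge0 // -powRrM.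
  by apply: ler_powR => //; rewrite ler1n.
move=> l s l0 hl us hs; apply: Dmax; apply: leq_trans (hC1 l l0 s us hs) _.
apply: leq_trans (leq_mul (leqnn _) hl) _.
by rewrite mulnA leq_mul2r leq_addr orbT.
Qed.

(** Since [u ^+ kappa + v ^+ kappa <= (u + v) ^+ kappa] and [c <= c ^+ kappa]. *)
Lemma root_split (kappa a : nat) (c u v : R) : (0 < kappa)%N -> 0 <= u -> 0 <= v ->
  1 <= c -> a%:R ^+ kappa <= c * (u ^+ kappa + v ^+ kappa) -> a%:R <= c * (u + v).
Proof.
move=> k0 u0 v0 c1 h.
have c0 : 0 <= c by apply: le_trans c1.
rewrite -(@ler_pXn2r _ kappa) ?nnegrE ?mulr_ge0 ?addr_ge0 //.
apply: le_trans h _; rewrite exprMn; apply: ler_pM.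
- by [].
- by rewrite addr_ge0 ?exprn_ge0.
- by case: kappa k0 => // n _; rewrite -{1}[c]expr1 ler_weXn2l.
elim: kappa k0 => // -[|n] IH _; first by rewrite !expr1.
rewrite ![_ ^+ n.+2]exprS.
apply: le_trans (_ : _ <= (u + v) * (u ^+ n.+1 + v ^+ n.+1)) _; last first.
  by rewrite ler_wpM2l ?addr_ge0 // IH.
rewrite -subr_ge0; set w := (X in 0 <= X).
have -> : w = u * v ^+ n.+1 + v * u ^+ n.+1 by rewrite /w; ring.
by rewrite addr_ge0 ?mulr_ge0 ?exprn_ge0.
Qed.

(** The bracket in the theorem for [k = m.+1], where [kappa = 2 ^+ m]. *)
Definition sieve_main (m : nat) (Q N : R) : R :=
  Q ^+ m.+2 + N * Q `^ (1 - (2 ^+ m)^-1)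
  + N `^ (1 - (2 ^+ m)^-1) * Q `^ (1 + m.+1%:R / 2 ^+ m).

Lemma sieve_main_ge0 m (Q N : R) : 0 <= Q -> 0 <= N -> 0 <= sieve_main m Q N.
Proof. by move=> Q0 N0; rewrite !addr_ge0 ?exprn_ge0 ?mulr_ge0 ?powR_ge0. Qed.

Lemma sieve_main_geN m (Q N : R) : 1 <= Q -> 0 <= N -> N <= sieve_main m Q N.
Proof.
move=> Q1 N0; rewrite /sieve_main -addrA addrCA.
apply: le_trans (_ : _ <= N * Q `^ (1 - (2 ^+ m)^-1)) _; last first.
  by rewrite lerDl addr_ge0 ?exprn_ge0 ?mulr_ge0 ?powR_ge0 // (le_trans _ Q1).
rewrite -{1}[N]mulr1 ler_wpM2l // -[leLHS](powRr0 Q) ler_powR //.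
by rewrite subr_ge0 invf_le1 ?exprn_gt0 // exprn_ege1 // ler1n.
Qed.

(* [u] and [v] below are the kappa-th roots of [1 / Q] and [Q ^ k / N]. *)
Lemma multiplicity_bound (m : nat) (C : nat) : exists C' : R, 1 <= C' /\
  forall (Q T D a p : nat) (N E : R), (0 < Q)%N -> 1 <= N -> (0 < D)%N ->
  1 <= E -> D%:R ^+ m.+1 <= E ->
  T%:R * N <= 2 * Q%:R ^+ (2 * m.+1) ->
  (a <= 8 * Q + 1)%N ->
  (p * Q ^ m.+1 <= a * (2 ^ m.+1 * (32 * T) + Q ^ m.+1))%N ->
  (a ^ (2 ^ m) * Q ^ m.+1 <= C * Q ^ (2 ^ m) * (Q ^ m + (1 + T) * D ^ m.+1))%N ->
  p%:R * N <= C' * E * sieve_main m Q%:R N.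
Proof.
pose c1 : R := 64 * 2 ^+ m.+1 + 1.
have c1_1 : 1 <= c1 by rewrite lerDr mulr_ge0 // exprn_ge0.
pose c2 : R := 2 * C%:R + 1.
have c2_1 : 1 <= c2 by rewrite lerDr mulr_ge0.
exists (9 * c1 * c2); split; first by nra.
move=> Q T D a p N E Q0 N1 D0 E1 hD hT ha hp hW.
set q : R := Q%:R in hT *.
have q1 : 1 <= q by rewrite ler1n.
have q0 : 0 < q by apply: lt_le_trans q1.
have N0 : 0 < N by apply: lt_le_trans N1.
have qk0 : 0 < q ^+ m.+1 by rewrite exprn_gt0.
have M0 := @sieve_main_ge0 m q N (ltW q0) (ltW N0).
have {}hp : p%:R * q ^+ m.+1 <= a%:R * (32 * 2 ^+ m.+1 * T%:R + q ^+ m.+1).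
  move: hp; rewrite -(ler_nat R) !natrM natrD !natrM !natrX -/q.
  by rewrite [2%:R ^+ _ * (_ * _)]mulrA [_ * 32%:R]mulrC.
have hT' : T%:R * N <= 2 * q ^+ m.+1 * q ^+ m.+1.
  by move: hT; rewrite mul2n -addnn exprD mulrA.
(* For [N] up to [q ^+ m.+1] the trivial bound for [a] yields the term [q ^+ m.+2]. *)
have [Nq|qN] := leP N (q ^+ m.+1).
  have pN : p%:R * N <= 9 * c1 * q ^+ m.+2.
    have a9 : a%:R <= 9 * q.
      by move: ha; rewrite -(ler_nat R) natrD natrM -/q; lra.
    rewrite -(ler_pM2r qk0) mulrAC.
    apply: le_trans (ler_wpM2r (ltW N0) hp) _.
    apply: le_trans (_ : _ <= 9 * q * (c1 * (q ^+ m.+1 * q ^+ m.+1))) _; last first.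
      by rewrite le_eqVlt [q ^+ m.+2]exprS; apply/orP; left; apply/eqP; ring.
    rewrite -[a%:R * _ * N]mulrA; apply: ler_pM => //.
      by rewrite mulr_ge0 ?(ltW N0) // addr_ge0 ?(ltW qk0) // !mulr_ge0 ?exprn_ge0.
    have := ler_wpM2l (ltW qk0) Nq.
    have := ler_wpM2l (_ : 0 <= 32 * 2 ^+ m.+1 :> R) hT'.
    rewrite mulr_ge0 ?exprn_ge0 // => /(_ isT).
    rewrite /c1; move: (2 ^+ m.+1) (q ^+ m.+1) => b Z h1 h2; nra.
  apply: le_trans pN _; apply: le_trans (_ : _ <= 9 * c1 * sieve_main m q N) _.
    rewrite ler_wpM2l ?mulr_ge0 ?(le_trans _ c1_1) //.
    by rewrite /sieve_main -addrA lerDl addr_ge0 ?mulr_ge0 ?powR_ge0 // ltW.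
  rewrite ler_wpM2r // -[leLHS]mulr1 -[_ * c2 * E]mulrA.
  apply: ler_wpM2l; first by rewrite mulr_ge0 // (le_trans _ c1_1).
  nra.
(* Now [T <= 2 * q ^+ m.+1], so each denominator carries a bounded number of numerators. *)
have pa : p%:R <= a%:R * c1.
  rewrite -(ler_pM2r qk0); apply: le_trans hp _.
  rewrite -[a%:R * _ * _]mulrA ler_wpM2l //.
  have T2 : T%:R <= 2 * q ^+ m.+1.
    rewrite -(ler_pM2r N0); apply: le_trans hT' _.
    by rewrite ler_wpM2l ?mulr_ge0 // ltW.
  have := ler_wpM2l (_ : 0 <= 32 * 2 ^+ m.+1 :> R) T2.
  rewrite mulr_ge0 ?exprn_ge0 // => /(_ isT).
  by rewrite /c1; move: (2 ^+ m.+1) (q ^+ m.+1) => b Z; lra.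
pose ka := (2 ^ m)%N.
have kaE : (2 ^+ m : R) = ka%:R by rewrite natrX.
have ka0 : (0 < ka)%N by rewrite expn_gt0.
have kaR : ka%:R != 0 :> R by rewrite pnatr_eq0 -lt0n.
pose u := q `^ (- (2 ^+ m)^-1); pose v := (q ^+ m.+1 / N) `^ (2 ^+ m)^-1.
have qN0 : 0 <= q ^+ m.+1 / N by rewrite divr_ge0 // ltW.
have uk : u ^+ ka = q^-1.
  rewrite -powR_mulrn ?powR_ge0 // -powRrM kaE mulNr mulVf // powRN.
  by rewrite powRr1 // ltW.
have vk : v ^+ ka = q ^+ m.+1 / N.
  by rewrite -powR_mulrn ?powR_ge0 // -powRrM kaE mulVf // powRr1.
have ab : a%:R <= c2 * E * q * (u + v).
  rewrite -!mulrA [q * _]mulrDr mulrA.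
  apply: root_split ka0 _ _ _ _.
  - by rewrite mulr_ge0 ?powR_ge0 // ltW.
  - by rewrite mulr_ge0 ?powR_ge0 // ltW.
  - nra.
  rewrite -(ler_pM2r qk0) !exprMn uk vk -mulrDr.
  move: hW; rewrite -(ler_nat R) !natrM natrD natrM natrD !natrX -/q -/ka.
  move/le_trans; apply.
  have qka : 0 <= q ^+ ka by rewrite exprn_ge0 // ltW.
  (* A factor [q ^+ m.+1] is pulled out to match the left side; [q ^+ m] absorbs the 1 of
     [1 + T]. *)
  have Y : q ^+ m + (1 + T%:R) * D%:R ^+ m.+1 <=
      E * (2 * (q^-1 + q ^+ m.+1 / N) * q ^+ m.+1).
    have qm : q^-1 * q ^+ m.+1 = q ^+ m by rewrite exprS mulKf // gt_eqF.
    have qm1 : 1 <= q ^+ m by rewrite exprn_ege1.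
    have TN : T%:R <= 2 * (q ^+ m.+1 / N) * q ^+ m.+1.
      rewrite -(ler_pM2r N0); apply: le_trans hT' _.
      rewrite le_eqVlt; apply/orP; left; apply/eqP; field; exact: lt0r_neq0.
    have h1 : (1 + T%:R) * D%:R ^+ m.+1 <= (1 + T%:R) * E.
      by rewrite ler_wpM2l // addr_ge0.
    rewrite [2 * _]mulrDr [(_ + _) * q ^+ _]mulrDl -[2 * q^-1 * _]mulrA qm.
    have h2 := ler_wpM2l (le_trans ler01 E1) TN.
    move: h1 h2; move: (2 * (_ / N) * _) (q ^+ m) (D%:R ^+ _) qm1 => Z W DD qm1.
    clear -E1 qm1; move: T%:R => tt h1 h2.
    have : W <= E * W by nra.
    have : E <= E * W by nra.
    nra.
  apply: le_trans (ler_wpM2l (_ : 0 <= C%:R * q ^+ ka) Y) _.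
    by rewrite mulr_ge0.
  have -> : C%:R * q ^+ ka * (E * (2 * (q^-1 + q ^+ m.+1 / N) * q ^+ m.+1)) =
    (2 * C%:R) * (E * (q ^+ ka * (q^-1 + q ^+ m.+1 / N)) * q ^+ m.+1) by ring.
  have -> : c2 * E * (q ^+ ka * (q^-1 + q ^+ m.+1 / N)) * q ^+ m.+1 =
    c2 * (E * (q ^+ ka * (q^-1 + q ^+ m.+1 / N)) * q ^+ m.+1) by ring.
  apply: ler_wpM2r; last by rewrite lerDl.
  rewrite !mulr_ge0 ?(ltW qk0) ?(le_trans _ E1) // addr_ge0 //.
  by rewrite invr_ge0 ltW.
have uE : q * u = q `^ (1 - (2 ^+ m)^-1).
  by rewrite powRD ?powRr1 ?(ltW q0) // (gt_eqF q0) implybT.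
have vE : N * (q * v) = N `^ (1 - (2 ^+ m)^-1) * q `^ (1 + m.+1%:R / 2 ^+ m).
  rewrite powRD; last by rewrite (gt_eqF N0) implybT.
  rewrite powRD; last by rewrite (gt_eqF q0) implybT.
  rewrite !powRr1 ?(ltW q0) ?(ltW N0) //.
  rewrite /v powRM ?(ltW qk0) ?invr_ge0 ?(ltW N0) //.
  rewrite -(@powR_mulrn _ q) ?(ltW q0) // -powRrM.
  by rewrite -(@powR_inv1 _ N) ?(ltW N0) // -powRrM mulN1r; ring.
have uvM : N * (q * (u + v)) <= sieve_main m q N.
  by rewrite mulrDr mulrDr uE vE /sieve_main -addrA lerDr exprn_ge0 // ltW.
apply: le_trans (ler_wpM2r (ltW N0) pa) _.
apply: le_trans (_ : _ <= c1 * c2 * E * sieve_main m q N) _; last first.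
  rewrite ler_wpM2r // ler_wpM2r ?(le_trans _ E1) // ler_wpM2r ?(le_trans _ c2_1) //.
  by move: c1_1; lra.
apply: le_trans (_ : _ <= c1 * c2 * E * (N * (q * (u + v)))) _; last first.
  by rewrite ler_wpM2l // !mulr_ge0 // ?(le_trans _ c1_1) ?(le_trans _ c2_1) ?(le_trans _ E1).
have -> : c1 * c2 * E * (N * (q * (u + v))) = c2 * E * q * (u + v) * c1 * N by ring.
by rewrite !ler_wpM2r ?(ltW N0) // (le_trans _ c1_1).
Qed.
End Reals.

(** * Fractions as points of the torus *)

Section Block.
Variable R : realType.

Lemma gintC_sub (x y : gint) : gintC R (x - y) = gintC R x - gintC R y.
Proof.
by case: x y => a b [c d]; rewrite gintN gintD /gintC /=; congr Complex;
  rewrite intrD intrN.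
Qed.

Lemma gintCD (x y : gint) : gintC R (x + y) = gintC R x + gintC R y.
Proof.
by case: x y => a b [c d]; rewrite gintD /gintC /=; congr Complex; rewrite intrD.
Qed.

Lemma gintCM (x y : gint) : gintC R (x * y) = gintC R x * gintC R y.
Proof.
by case: x y => a b [c d]; rewrite gintM /gintC /=; congr Complex;
  rewrite ?intrB ?intrD !intrM.
Qed.

Lemma gintCX (x : gint) n : gintC R (x ^+ n) = gintC R x ^+ n.
Proof.
elim: n => [|n IH]; last by rewrite exprS gintCM IH exprS.
by rewrite !expr0; congr Complex.
Qed.

Lemma nsq_gintC (x : gint) : nsq (gintC R x) = (nrm x)%:R.
Proof.
rewrite /nsq /= -!rmorphXn -rmorphD /=.
by have := gnormE x; rewrite /Defs.gnorm => ->; rewrite -pmulrn.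
Qed.

Lemma gintC_neq0 (x : gint) : x != 0 -> gintC R x != 0.
Proof.
move=> x0; apply/eqP => E; have := nsq_gintC x; rewrite E /nsq /= expr0n /= addr0.
by move/eqP; rewrite eq_sym pnatr_eq0 nrm_eq0 (negPf x0).
Qed.

(** The minus sign reflects [Re (n w) = Re n Re w - Im n Im w], while [chi] has a plus sign. *)
Definition frac_point (k : nat) (x : gint * gint) : R * R :=
  let w := gintC R x.2 / gintC R x.1 ^+ k in (complex.Re w, - complex.Im w).

Lemma e_frac_point (k : nat) (n q r : gint) :
  e (complex.Re (gintC R n * gintC R r / gintC R q ^+ k)) =
  chi n (frac_point k (q, r)).
Proof.
rewrite -mulrA /chi /frac_point /=; case: (_ / _) n => x y [a b] /=.
by congr e; ring.
Qed.

(** The two fractions differ, up to the lattice vector [z], by a number of squared modulus at most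
    [2 / L^2]; clear both denominators. *)
Lemma close_frac (k L : nat) (x y : gint * gint) : x.1 != 0 -> y.1 != 0 ->
  closeb L (frac_point k x) (frac_point k y) ->
  exists z : gint, (nrm (x.2 * y.1 ^+ k - (y.2 + z * y.1 ^+ k) * x.1 ^+ k)%R * L ^ 2
     <= 2 * (nrm x.1 ^ k * nrm y.1 ^ k))%N.
Proof.
case: x y => q0 r0 [q r] /= q00 qn0 /asboolP[[z1 z2]].
rewrite /frac_point /=; set w0 := _ / _; set w := gintC R r / _ => -[h1 h2].
exists (Complex z1 (- z2)); rewrite -(ler_nat R) !natrM !natrX.
have Q0 : gintC R q0 ^+ k != 0 by rewrite expf_neq0 // gintC_neq0.
have Q1 : gintC R q ^+ k != 0 by rewrite expf_neq0 // gintC_neq0.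
pose z : gint := Complex z1 (- z2); rewrite -/z.
have E : gintC R (r0 * q ^+ k - (r + z * q ^+ k) * q0 ^+ k) =
   (w0 - w - gintC R z) * (gintC R q0 ^+ k * gintC R q ^+ k).
  rewrite gintC_sub !gintCM gintCD gintCM !gintCX.
  have -> : gintC R r0 = w0 * gintC R q0 ^+ k by rewrite /w0 divfK.
  have -> : gintC R r = w * gintC R q ^+ k by rewrite /w divfK.
  by ring.
rewrite -nsq_gintC E !nsqM -!gintCX !nsq_gintC !nrmX !natrX mulrAC.
apply: ler_wpM2r; first by rewrite mulr_ge0 // exprn_ge0.
have sq (a : R) : `|a| * L%:R < 1 -> a ^+ 2 * L%:R ^+ 2 <= 1.
  move=> ha; rewrite -exprMn -real_normK ?num_real // normrM.
  rewrite [`|L%:R|]ger0_norm ?ler0n // expr_le1 ?mulr_ge0 //; exact: ltW.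
have {}h1 := sq _ h1; have {}h2 := sq _ h2.
rewrite /nsq mulrDl; apply: le_trans (_ : _ <= 1 + 1) _; last by lra.
apply: lerD.
  by move: h1; rewrite /z; case: (w0) (w) => ? ? [? ?].
move: h2; rewrite /z; case: (w0) (w) => x1 y1 [x2 y2] /=.
by rewrite -sqrrN; congr (_ ^+ 2 * _ <= _); rewrite intrN; ring.
Qed.
End Block.

(** * One dyadic block *)

Section BlockSieve.
Variable R : realType.

Definition separated (k : nat) (P : seq (gint * gint)) :=
  forall x y, x \in P -> y \in P -> x.1 = y.1 -> gdvd (x.1 ^+ k) (x.2 - y.2) -> x = y.

(** Translating each numerator by a multiple of [y.1 ^+ k] turns closeness modulo the lattice into
    genuine closeness, and [separated] keeps the translated pairs distinct. *)
Lemma count_close (k : nat) (P : seq (gint * gint)) (x : gint * gint) (Q L T : nat) :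
  (0 < L)%N -> (0 < Q)%N -> uniq P -> separated k P -> x \in P ->
  (forall y, y \in P -> y.1 != 0 /\ (nrm y.1 <= Q)%N) ->
  (2 * Q ^ (2 * k) < T.+1 * L ^ 2)%N ->
  exists P' : seq (gint * gint), [/\ uniq P',
    count (fun y => closeb L (frac_point R k x) (frac_point R k y)) P = size P' &
    forall y, y \in P' -> (nrm y.1 <= Q)%N /\
      (nrm (x.2 * y.1 ^+ k - y.2 * x.1 ^+ k)%R <= T)%N].
Proof.
move=> L0 Q0 uP sP xP hP hT.
set cl := fun y => closeb _ _ _.
have /choice[f hf] : forall y, exists z : gint, y \in P -> cl y ->
    (nrm (x.2 * y.1 ^+ k - (y.2 + z * y.1 ^+ k) * x.1 ^+ k)%R * L ^ 2
     <= 2 * (nrm x.1 ^ k * nrm y.1 ^ k))%N.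
  move=> y; have [yP|] := boolP (y \in P); last by exists 0.
  have [cy|] := boolP (cl y); last by exists 0.
  by have [z hz] := close_frac (hP x xP).1 (hP y yP).1 cy; exists z.
exists [seq (y.1, y.2 + f y * y.1 ^+ k) | y <- [seq y <- P | cl y]]; split.
- rewrite map_inj_in_uniq ?filter_uniq // => y y'.
  rewrite !mem_filter => /andP[_ yP] /andP[_ yP'] [e1 e2]; apply: sP => //.
  exists (f y' - f y); rewrite -e1 in e2.
  have -> : y.2 = y'.2 + f y' * y.1 ^+ k - f y * y.1 ^+ k by rewrite -e2 addrK.
  by ring.
- by rewrite size_map size_filter.
move=> ? /mapP[y]; rewrite mem_filter => /andP[cy yP] -> /=.
split; first by case: (hP y yP).
have := hf y yP cy; move: (nrm (_ - _)) => n hn.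
have L2 : (0 < L ^ 2)%N by rewrite expn_gt0 L0.
rewrite -ltnS -(ltn_pmul2r L2); apply: leq_ltn_trans hn _; apply: leq_ltn_trans hT.
rewrite leq_mul2l /= mul2n -addnn expnD.
by apply: leq_mul; apply: leq_expn2r; [case: (hP x xP) | case: (hP y yP)].
Qed.

Lemma block_sieve (m : nat) (eps : R) : 0 < eps -> exists C : R, 0 < C /\
  forall (Q s : nat) (N : R) (P : seq (gint * gint)) (a : gint -> R[i]),
  (0 < Q)%N -> 1 <= N -> s%:R ^+ 2 <= N -> N < s.+1%:R ^+ 2 ->
  uniq P -> separated m.+1 P ->
  (forall x, x \in P -> [/\ (Q <= 2 * nrm x.1)%N, (nrm x.1 <= Q)%N & gcoprime x.2 x.1]) ->
  \sum_(x <- P) cabs (\sum_(n <- gboxl s) a n * chi n (frac_point R m.+1 x)) ^+ 2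
  <= C * Q%:R `^ eps * sieve_main m Q%:R N * \sum_(n <- gboxl s) cabs (a n) ^+ 2.
Proof.
move=> eps0; have [C0 hC0] := block_multiplicity m.
have [C3 [C31 hC3]] := divisor_count m.+1 C0 eps0.
have [C' [C'1 hC']] := multiplicity_bound R m C0.
have [c [c0 ls]] := large_sieve R.
exists (c * 50 * C' * C3); split.
  by rewrite !mulr_gt0 ?(lt_le_trans ltr01 C'1) ?(lt_le_trans ltr01 C31).
move=> Q s N P a Q0 N1 sN Ns uP sP hP.
have N0 : 0 < N by apply: lt_le_trans N1.
have [D [D0 hD hdiv]] := hC3 Q Q0.
set L := (4 * s).+1; set E := C3 * Q%:R `^ eps in hD.
have Q1 : 1 <= Q%:R :> R by rewrite ler1n.
have E1 : 1 <= E.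
  rewrite /E -[leLHS]mulr1; apply: ler_pM => //.
  by rewrite -[leLHS](powRr0 Q%:R) ler_powR // ltW.
set M := sieve_main m Q%:R N.
have s0 : (0 < s)%N.
  case: s Ns {sN L} => // /lt_le_trans/(_ (_ : 1 ^+ 2 <= N)).
  by rewrite expr1n ltxx => /(_ N1).
have NL : N <= L%:R ^+ 2.
  apply: ltW; apply: lt_le_trans Ns _.
  by rewrite -!natrX ler_nat leq_sqr /L ltnS; clear; lia.
have LN : L%:R ^+ 2 <= 25 * N.
  apply: le_trans (_ : _ <= 25 * s%:R ^+ 2) _; last by rewrite ler_pM2l.
  rewrite -!natrX -natrM ler_nat -(expnMn 5 _ 2) leq_sqr /L; clear -s0; lia.
pose T := ((2 * Q ^ (2 * m.+1)) %/ L ^ 2)%N.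
have L2 : (0 < L ^ 2)%N by rewrite expn_gt0.
have TN : T%:R * N <= 2 * Q%:R ^+ (2 * m.+1).
  apply: le_trans (ler_wpM2l _ NL) _; first exact: ler0n.
  by rewrite -!natrX -!natrM ler_nat leq_trunc_div.
have M0 : 0 <= M by apply: sieve_main_ge0; rewrite ?ler0n // ltW.
have NM : N <= M by apply: sieve_main_geN => //; exact: ltW.
(* The multiplicity given by [multiplicity_bound]; rounding it up to an integer adds at most 1,
   which [N <= M] absorbs. *)
pose B := C' * E * M / N.
have B0 : 0 <= B.
  by rewrite divr_ge0 ?(ltW N0) // !mulr_ge0 // (le_trans ler01).
have /andP[B1 B2] := truncn_itv B0.
have hcount x : x \in P ->
   (count (fun y => closeb L (frac_point R m.+1 x) (frac_point R m.+1 y)) P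
     <= (Num.trunc B).+1)%N.
  move=> xP; have hT : (2 * Q ^ (2 * m.+1) < T.+1 * L ^ 2)%N by rewrite ltn_ceil.
  have hP' y : y \in P -> y.1 != 0 /\ (nrm y.1 <= Q)%N.
    by move=> /hP[h1 h2 _]; rewrite -nrm_gt0; split=> //; clear -Q0 h1; lia.
  have [P' [uP' -> hP1]] := count_close (ltn0Sn _) Q0 uP sP xP hP' hT.
  have [x1 x2 x3] := hP x xP.
  have [A [A1 A2 A3]] := hC0 Q T D x.1 x.2 P' Q0 x1 x2 x3 uP' hP1 hdiv.
  have h := hC' Q T D A (size P') N E Q0 N1 D0 E1 hD TN A1 A2 A3.
  apply: ltnW; rewrite -(ltr_nat R); apply: le_lt_trans B2.
  by rewrite /B ler_pdivlMr.
apply: le_trans (ls _ _ _ _ _ (ltn0Sn _) hcount a) _.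
apply: ler_wpM2r.
  by apply: sumr_ge0 => n _; exact: sqr_ge0.
(* The [50] is [2 * 25], from [L ^+ 2 <= 25 * N] and [N <= C' * E * M]. *)
have hK : (Num.trunc B).+1%:R * L%:R ^+ 2 <= 50 * (C' * E * M).
  apply: le_trans (_ : _ <= (B + 1) * (25 * N)) _.
    apply: ler_pM => //; rewrite ?exprn_ge0 ?ler0n //.
    by rewrite -natr1 lerD2r.
  have BN : B * N = C' * E * M by rewrite /B divfK // gt_eqF.
  have : M <= C' * E * M.
    rewrite -[leLHS]mul1r ler_wpM2r //; nra.
  by rewrite -BN; lra.
rewrite -mulrA.
apply: le_trans (ler_wpM2l (ltW c0) hK) _.
by rewrite le_eqVlt /E; apply/orP; left; apply/eqP; ring.
Qed.
End BlockSieve.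

(** * Summation over dyadic blocks *)

Section Dyadic.
Variable R : realType.

Lemma le_powR (x y r : R) : 0 <= r -> 0 <= x -> x <= y -> x `^ r <= y `^ r.
Proof.
move=> r0 x0 xy; apply: ge0_ler_powR => //; rewrite nnegrE //; exact: le_trans xy.
Qed.

Lemma sieve_main_le m (P Q N : R) : 0 <= P -> P <= Q -> 0 <= N ->
  sieve_main m P N <= sieve_main m Q N.
Proof.
move=> P0 PQ N0; have Q0 := le_trans P0 PQ.
rewrite /sieve_main !lerD ?lerXn2r ?ler_wpM2l ?powR_ge0 ?le_powR //.
by rewrite subr_ge0 invf_le1 ?exprn_gt0 // exprn_ege1 // ler1n.
Qed.

Lemma dyadic_sieve (m : nat) (eps : R) : 0 < eps -> exists C : R, 0 < C /\
  forall (Q s : nat) (N : R) (P : seq (gint * gint)) (a : gint -> R[i]),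
  (0 < Q)%N -> 1 <= N -> s%:R ^+ 2 <= N -> N < s.+1%:R ^+ 2 ->
  uniq P -> separated m.+1 P ->
  (forall x, x \in P -> [/\ x.1 != 0, (nrm x.1 <= Q)%N & gcoprime x.2 x.1]) ->
  \sum_(x <- P) cabs (\sum_(n <- gboxl s) a n * chi n (frac_point R m.+1 x)) ^+ 2
  <= C * Q%:R `^ eps * sieve_main m Q%:R N * \sum_(n <- gboxl s) cabs (a n) ^+ 2.
Proof.
move=> eps0; have [c [c0 hc]] := block_sieve m eps0.
pose d : R := 2^-1 `^ eps.
have d1 : d < 1.
  have h2 : (2^-1 : R) \in Num.nneg by rewrite nnegrE invr_ge0.
  have h1 : (1 : R) \in Num.nneg by rewrite nnegrE.
  have := gt0_ltr_powR eps0 h2 h1; rewrite powR1; apply.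
  by rewrite invf_lt1 ?ltr1n.
have d0 : 0 <= d by exact: powR_ge0.
have d1' : 0 < 1 - d by rewrite subr_gt0.
(* This choice closes the induction: the top block contributes [c], and the rest, of norm at most
   [Q / 2], contributes [C * d]. *)
have [C [C0 CE]] : exists C, 0 < C /\ c + C * d = C.
  by exists (c / (1 - d)); rewrite divr_gt0 //; split=> //; field; exact: lt0r_neq0.
exists C; split=> // Q s N P a Q0 N1 sN Ns; have N0 : 0 <= N by apply: le_trans N1.
have [n] := ubnP Q; elim: n Q P Q0 => // n IH Q P Q0 Qn uP sP hP.
set Z := \sum_(n <- gboxl s) _.
have Z0 : 0 <= Z by apply: sumr_ge0 => i _; exact: sqr_ge0.
pose G x : R := cabs (\sum_(n <- gboxl s) a n * chi n (frac_point R m.+1 x)) ^+ 2.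
rewrite -[X in X <= _]/(\sum_(x <- P) G x).
set p := fun x : gint * gint => (Q <= 2 * nrm x.1)%N.
rewrite (bigID p) /= -big_filter -[X in _ + X]big_filter.
have sub (b : pred (gint * gint)) x : x \in [seq x <- P | b x] -> x \in P.
  by rewrite mem_filter => /andP[].
have sep (b : pred (gint * gint)) : separated m.+1 [seq x <- P | b x].
  by move=> x y xP yP; exact: (sP x y (sub b x xP) (sub b y yP)).
set E := Q%:R `^ eps; set M := sieve_main m Q%:R N.
have E0 : 0 <= E by exact: powR_ge0.
have M0 : 0 <= M by exact: sieve_main_ge0.
have b1 : \sum_(x <- [seq x <- P | p x]) G x <= c * E * M * Z.
  apply: (hc Q s N) => //; first exact: filter_uniq.
  by move=> x; rewrite mem_filter => /andP[px /hP[_ h1 h2]].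
have b2 : \sum_(x <- [seq x <- P | ~~ p x]) G x <= C * d * E * M * Z.
  (* For [Q = 1] the lower part could only contain denominators of norm 0. *)
  have [Q1|Q1] := leqP Q 1.
    rewrite big_seq big1 => [|x]; first by rewrite !mulr_ge0 // (ltW C0).
    rewrite mem_filter => /andP[px /hP[h1 _ _]]; move: px h1.
    by rewrite /p -nrm_gt0; move: (nrm _) => w h1 h2; clear -Q1 h1 h2; lia.
  have Q2 : (0 < Q./2)%N by rewrite half_gt0.
  have Q3 : (Q./2 < n)%N.
    have := odd_double_half Q; rewrite -addnn; clear -Q2 Qn; lia.
  apply: le_trans (IH Q./2 _ Q2 Q3 (filter_uniq _ uP) (sep (fun x => ~~ p x)) _) _.
    move=> x; rewrite mem_filter => /andP[px /hP[h1 _ h2]]; split=> //.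
    move: px; rewrite /p -ltnNge; move: (nrm _) => w h.
    have := odd_double_half Q; rewrite -addnn; case: (odd Q); clear -h; lia.
  have hQ : (Q./2)%:R <= Q%:R / 2 :> R.
    rewrite ler_pdivlMr // -natrM ler_nat.
    have := odd_double_half Q; rewrite -addnn; clear; lia.
  apply: ler_wpM2r => //; apply: ler_pM.
  - by rewrite mulr_ge0 ?powR_ge0 // ltW.
  - exact: sieve_main_ge0.
  - rewrite -mulrA ler_pM2l // /d /E -powRM ?invr_ge0 //.
    by rewrite mulrC; apply: le_powR => //; exact: ltW.
  apply: sieve_main_le => //; apply: le_trans hQ _.
  by rewrite ler_pdivrMr // ler_peMr // ler1n.
apply: le_trans (lerD b1 b2) _; rewrite -!mulrDl.
by rewrite CE.
Qed.

Lemma mem_finite_support (T : choiceType) (V : Type) (v : V) (D : set T)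
    (F : T -> V) x : x \in finite_support v D F -> D x.
Proof. by case: finite_supportP => // X XD _ _ /XD. Qed.

Lemma gball_seq (N : R) (s : nat) : 0 <= N -> N < s.+1%:R ^+ 2 ->
  gball N = [set` [seq n <- gboxl s | (Defs.gnorm n)%:~R <= N]].
Proof.
move=> N0 Ns; apply/seteqP; split=> n.
  rewrite /gball /= => h; change (n \in [seq n <- gboxl s | (Defs.gnorm n)%:~R <= N]).
  rewrite mem_filter h /=; move: (le_lt_trans h Ns).
  rewrite gnormE -pmulrn -natrX ltr_nat => h2.
  apply: (@gboxl_isqrt s (nrm n)) => //.
move=> h; have : n \in [seq n <- gboxl s | (Defs.gnorm n)%:~R <= N] by [].
by rewrite mem_filter => /andP[].
Qed.
End Dyadic.

Lemma separated_residues (k : nat) (P : seq (gint * gint)) (reps : gint -> set gint) :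
  (forall q : gint, q != 0 -> residue_system (q ^+ k) (reps q)) ->
  (forall x, x \in P -> x.1 != 0 /\ reps x.1 x.2) -> separated k P.
Proof.
move=> hres hP [q r] [q' r'] /hP[/= q0 hr] /hP[/= _ hr'] qE; subst q'.
move=> hd; congr pair; have [r0 [_ u]] := hres q q0 r.
rewrite -(u r) ?(u r') //; split=> //.
by exists 0; rewrite subrr mulr0.
Qed.

Theorem theorem2 (R : realType) (k : nat) (hk : (0 < k)%N)
    (eps : R) (heps : 0 < eps) :
  let kappa : R := 2 ^+ k.-1 in
  exists C : R, 0 < C /\
    forall (Q N : R) (a : gint -> R[i]) (reps : gint -> set gint),
    1 <= Q -> 1 <= N ->
    (forall q : gint, q != 0 -> residue_system (q ^+ k) (reps q)) ->
    \sum_(q \in gball Q `\ 0)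
      \sum_(r \in reps q `&` [set r | gcoprime r q])
        cabs (\sum_(n \in gball N)
                a n * e (complex.Re (gintC R n * gintC R r / gintC R q ^+ k)))
          ^+ 2
    <= C * (Q * N) `^ eps
       * (Q ^+ k.+1 + N * Q `^ (1 - kappa^-1)
          + N `^ (1 - kappa^-1) * Q `^ (1 + k%:R / kappa))
       * \sum_(n \in gball N) cabs (a n) ^+ 2.
Proof.
case: k hk => // m _ /=; have [C [C0 hC]] := dyadic_sieve m heps.
exists C; split=> // Q N a reps Q1 N1 hres.
have Q0 : 0 <= Q by apply: le_trans Q1.
have N0 : 0 <= N by apply: le_trans N1.
have /andP[q1 q2] := truncn_itv Q0; have /andP[n1 n2] := truncn_itv N0.
(* Norms are integers, so [Q] may be replaced by its integer part, and the disc of [N] lies in the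
   square whose half-side is the integer part of its radius. *)
set q0 := Num.trunc Q in q1 q2; set n0 := Num.trunc N in n1 n2.
have q00 : (0 < q0)%N by rewrite -ltnS -(ltr_nat R); exact: le_lt_trans Q1 q2.
have [s [s1 s2]] := isqrt_ex n0.
have sN : s%:R ^+ 2 <= N by apply: le_trans n1; rewrite -natrX ler_nat.
have Ns : N < s.+1%:R ^+ 2.
  by apply: lt_le_trans n2 _; rewrite -natrX ler_nat.
set B := [seq n <- gboxl s | (Defs.gnorm n)%:~R <= N].
have uB : uniq B by rewrite filter_uniq // uniq_gboxl.
(* Extension of [a] by zero from the disc to the square. *)
pose b n : R[i] := if (Defs.gnorm n)%:~R <= N then a n else 0.
rewrite (gball_seq N0 Ns) -/B -(fsbig_seq _ _ uB).
have -> : \sum_(n <- B) cabs (a n) ^+ 2 = \sum_(n <- gboxl s) cabs (b n) ^+ 2.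
  rewrite big_filter big_mkcond; apply: eq_bigr => n _; rewrite /b; case: ifP => // _.
  by rewrite cabs_sqr /nsq /= expr0n addr0.
(* Sums over sets run over the finite support of the summand, so [S] and [Sr q] list only indices
   with a nonzero term; [P] collects the resulting pairs. *)
set S := finite_support _ _ _.
pose Sr q := finite_support 0 (reps q `&` [set r | gcoprime r q])
  (fun r => cabs (\sum_(n \in [set` B])
     a n * e (complex.Re (gintC R n * gintC R r / gintC R q ^+ m.+1))) ^+ 2).
pose P : seq (gint * gint) := [seq (q, r) | q <- S, r <- Sr q].
have Pq x : x \in P -> [/\ x.1 != 0, (nrm x.1 <= q0)%N, reps x.1 x.2 & gcoprime x.2 x.1].
  case/allpairsPdep => q [r [qS rS ->]] /=.
  have [hq qn0] : (gball Q `\ 0) q by exact: mem_finite_support qS.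
  have [hr co] : (reps q `&` [set r | gcoprime r q]) r by exact: mem_finite_support rS.
  split=> //; first by apply/eqP.
  move: hq; rewrite /gball /= gnormE -pmulrn => hq; rewrite -ltnS -(ltr_nat R).
  exact: le_lt_trans hq q2.
have uP : uniq P.
  apply: allpairs_uniq_dep => [|q _|]; [exact: finite_support_uniq..|].
  by move=> [q r] [q' r'] _ _ [-> ->].
have sepP : separated m.+1 P.
  by apply: (separated_residues hres) => x /Pq[].
have hP x : x \in P -> [/\ x.1 != 0, (nrm x.1 <= q0)%N & gcoprime x.2 x.1].
  by case/Pq.
have := hC q0 s N P b q00 N1 sN Ns uP sepP hP.
set Z := \sum_(n <- gboxl s) cabs (b n) ^+ 2 => main.
have Z0 : 0 <= Z by apply: sumr_ge0 => n _; exact: sqr_ge0.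
have {main} : \sum_(q <- S) \sum_(r <- Sr q) cabs (\sum_(n \in [set` B])
     a n * e (complex.Re (gintC R n * gintC R r / gintC R q ^+ m.+1))) ^+ 2 <=
   C * q0%:R `^ eps * sieve_main m q0%:R N * Z.
  apply: le_trans main; rewrite big_allpairs_dep le_eqVlt; apply/orP; left; apply/eqP.
  apply: eq_bigr => q _; apply: eq_bigr => r _; congr (cabs _ ^+ 2).
  rewrite -fsbig_seq // big_filter big_mkcond; apply: eq_bigr => n _.
  by rewrite e_frac_point /b; case: ifP => // _; rewrite mul0r.
move/le_trans; apply; apply: ler_wpM2r => //.
apply: ler_pM.
- by rewrite mulr_ge0 ?powR_ge0 // ltW.
- exact: sieve_main_ge0.
- rewrite ler_pM2l //; apply: le_powR => //; first exact: ltW.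
  by apply: le_trans q1 _; rewrite ler_peMr.
exact: sieve_main_le.
Qed.
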